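(* For each $n\ge 1$, let $\tau_n$ be a uniformly distributed random plane binary tree of size $n$ and let $\nu_{\tau_n}$ be its leaf-growth measure. Set $\gamma=3(2-\sqrt{3})$. For all $\epsilon>0$, $$\lim_{n\to\infty}\nu_{\tau_n}\big(\{l \text{ leaf of } \tau_n : n^{-\gamma-\epsilon}\leq \nu_{\tau_n}(l)\leq n^{-\gamma+\epsilon}\}\big)=1$$ in probability. As a consequence, for all $\epsilon>0$ and all $\delta\in(0,1)$, with probability tending to $1$ as $n\to\infty$ there exists a set $A_{n,\delta}$ of leaves of $\tau_n$ such that $\nu_{\tau_n}(A_{n,\delta})\geq 1-\delta$ and $|A_{n,\delta}|\leq n^{\gamma+\epsilon}$. Moreover, for all $\epsilon>0$, the maximum of $\nu_{\tau_n}(A)$ over all sets $A$ of leaves of $\tau_n$ with $|A|\le n^{\gamma-\epsilon}$ tends to $0$ in probability as $n\to\infty$.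
   Context: A (plane) binary tree is a finite rooted plane tree in which every vertex has either $2$ children (internal vertex) or $0$ children (leaf). Its size is its number of internal vertices; a tree of size $n$ has $n+1$ leaves. $\tau_n$ is uniform on the finite set of binary trees of size $n$. For integers $a,b\ge 0$ set $$C(a,b)=\frac{(a+1)(2a+1)(a+3b+3)}{(a+b+1)(a+b+2)(2(a+b)+3)}.$$ One has $C(a,b)+C(b,a)=1$. The leaf-growth measure $\nu_t$ of a binary tree $t$ is the probability measure on the leaves of $t$ defined recursively as follows: if $t$ has size $0$, $\nu_t$ is the Dirac mass at the only vertex; otherwise, if $t^L$, $t^R$ are the left and right subtrees of the root, of sizes $|t^L|,|t^R|$, then for every leaf $l$ of $t$, $$\nu_t(l)=\mathbf 1_{l\in t^L}\,C(|t^L|,|t^R|)\,\nu_{t^L}(l)+\mathbf 1_{l\in t^R}\,C(|t^R|,|t^L|)\,\nu_{t^R}(l).$$ Equivalently, $\nu_t(l)=\prod_{i=1}^{|l|}C(a_i,b_i)$ where $|l|$ is the height of $l$, $a_i$ is the size of the subtree of descendants of the ancestor $v_i$ of $l$ at height $i$ (including $v_i$), and $b_i$ is the size of the subtree of descendants of the sibling of $v_i$. *)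

(* Defs.v *)
From HB Require Import structures.
From mathcomp Require Import all_boot all_order all_algebra.
From mathcomp Require Import all_classical reals topology normedtype exp.
From mathcomp Require Import ring.
Import Order.TTheory GRing.Theory Num.Theory.
Import numFieldNormedType.Exports.

Set Implicit Arguments.
Unset Strict Implicit.
Unset Printing Implicit Defensive.

Local Open Scope classical_set_scope.
Local Open Scope ring_scope.

Inductive bintree : Type := Leaf | Node of bintree & bintree.

Fixpoint bintree_code (t : bintree) : GenTree.tree unit :=
  if t is Node t1 t2 then GenTree.Node 0 [:: bintree_code t1; bintree_code t2]
  else GenTree.Leaf tt.

Fixpoint bintree_decode (c : GenTree.tree unit) : bintree :=
  if c is GenTree.Node _ [:: c1; c2]
  then Node (bintree_decode c1) (bintree_decode c2) else Leaf.

Lemma bintree_codeK : cancel bintree_code bintree_decode.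
Proof. by elim=> //= t1 -> t2 ->. Qed.

HB.instance Definition _ := Countable.copy bintree (can_type bintree_codeK).

(* The size of a tree is its number of internal vertices. *)
Fixpoint tsize (t : bintree) : nat :=
  if t is Node t1 t2 then (tsize t1 + tsize t2).+1 else 0%N.

Record bintree_of (n : nat) : Type :=
  BintreeOf { tree_val :> bintree; _ : tsize tree_val == n }.

HB.instance Definition _ n := [isSub for @tree_val n].
HB.instance Definition _ n := [Countable of bintree_of n by <:].

(* All the trees of height at most h, in particular all those of size at      *)
(* most h.                                                                    *)
Fixpoint bintrees_height (h : nat) : seq bintree :=
  if h is h'.+1 then
    Leaf :: [seq Node t1 t2 | t1 <- bintrees_height h', t2 <- bintrees_height h']
  else [:: Leaf].

Lemma mem_bintrees_height h t : (tsize t <= h)%N -> t \in bintrees_height h.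
Proof.
elim: h t => [|h IHh] [|t1 t2] //=; rewrite ltnS => le_h.
rewrite inE /=; apply/allpairsP; exists (t1, t2); split => //=; apply: IHh.
  exact: leq_trans (leq_addr _ _) le_h.
exact: leq_trans (leq_addl _ _) le_h.
Qed.

Definition bintree_of_enum n : seq (bintree_of n) :=
  undup (pmap insub (bintrees_height n)).

Lemma mem_bintree_of_enum n (t : bintree_of n) : t \in bintree_of_enum n.
Proof.
rewrite mem_undup mem_pmap_sub mem_bintrees_height //.
by rewrite (eqP (valP t)).
Qed.

HB.instance Definition _ n := isFinite.Build (bintree_of n)
  (Finite.uniq_enumP (undup_uniq _) (@mem_bintree_of_enum n)).

(* The leaves of [t], as a finite type: those of [Node t1 t2] are the         *)
(* disjoint union of those of its left and right subtrees.                    *)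
Fixpoint leaf (t : bintree) : finType :=
  if t is Node t1 t2 then (leaf t1 + leaf t2)%type else unit.

Lemma card_leaf t : #|leaf t| = (tsize t).+1.
Proof.
elim: t => [|t1 IH1 t2 IH2] /=; first by rewrite card_unit.
by rewrite card_sum IH1 IH2 addSn addnS.
Qed.

Section LeafGrowthMeasure.
Variable R : realType.

Definition growthC (a b : nat) : R :=
  ((a + 1) * (2 * a + 1) * (a + 3 * b + 3))%N%:R
  / ((a + b + 1) * (a + b + 2) * (2 * (a + b) + 3))%N%:R.

Lemma growthC_sum1 a b : growthC a b + growthC b a = 1.
Proof.
rewrite /growthC [(b + a)%N]addnC -mulrDl -natrD.
rewrite (_ : (_ + _)%N = ((a + b + 1) * (a + b + 2) * (2 * (a + b) + 3))%N).
  by rewrite divff // pnatr_eq0 !addn1 !addn2 !addn3 /=.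
ring.
Qed.

(* The mass given by the leaf-growth measure of [t] to a single leaf.         *)
Fixpoint leaf_weight (t : bintree) : leaf t -> R :=
  match t return leaf t -> R with
  | Leaf => fun=> 1
  | Node t1 t2 => fun l => match l with
    | inl l1 => growthC (tsize t1) (tsize t2) * leaf_weight l1
    | inr l2 => growthC (tsize t2) (tsize t1) * leaf_weight l2
    end
  end.

Definition leaf_measure (t : bintree) (A : {set leaf t}) : R :=
  \sum_(l in A) leaf_weight l.

Lemma leaf_weight_ge0 t (l : leaf t) : 0 <= leaf_weight l.
Proof.
by elim: t l => [|t1 IH1 t2 IH2] //= [l|l]; rewrite mulr_ge0 ?divr_ge0 ?ler0n.
Qed.

Lemma leaf_measure_setT t : leaf_measure [set: leaf t] = 1.
Proof.
rewrite /leaf_measure (eq_bigl xpredT); last by move=> l; rewrite finset.in_setT.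
elim: t => [|t1 IH1 t2 IH2] /=; first by rewrite (big_pred1 tt) //; case.
by rewrite big_sumType /= -!mulr_sumr IH1 IH2 !mulr1 growthC_sum1.
Qed.

(* Probability of the event [E] under the uniform law on [T].                 *)
Definition unif_prob (T : finType) (E : pred T) : R := #|E|%:R / #|T|%:R.

(* [X n] is a function of a uniform tree of size [n]; the probability space   *)
(* thus depends on [n], so the limit has to be a constant.                    *)
Definition cvg_in_prob (X : forall n, bintree_of n -> R) (c : R) : Prop :=
  forall eta : R, 0 < eta ->
    unif_prob (fun t : bintree_of n => eta < `|X n t - c|) @[n --> \oo] --> 0.

Definition gamma : R := 3 * (2 - Num.sqrt 3).

End LeafGrowthMeasure.

(* Main.v *)
(* Sample a leaf from the leaf-growth measure of a uniform tree of size n. The  *)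
(* sizes of the subtrees met from the root to that leaf form a Markov chain:    *)
(* writing e_a(k) for the coefficient of x^k in (1 - x)^(-a), it steps from n   *)
(* to k < n with probability                                                    *)
(*     p_n(k) = - e_{3/2}(k) e_{-1/2}(n - k) (3n - 2k) / (n e_{3/2}(n)).        *)
(* Since C(k, n-1-k) = (k+1)(2k+1) / ((n+1)(2n+1)) * (3 - 2k/n), the logarithm  *)
(* of the weight of the leaf is - ln ((n+1)(2n+1)) plus the sum of              *)
(* ln (3 - 2k/n) over the steps of the chain. Vandermonde's identity gives      *)
(*     sum_k e_a(k) e_b(n-k) (3n - 2k) = (a + 3b) e_{a+b+1}(n-1),               *)
(* which makes the chain solvable. Its derivative in a at (3/2, -1/2) shows     *)
(* that H(n) = sum_(i<n) 1 / (i + 3/2) ~ ln n has mean decrement exactly        *)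
(* B_n = 1 / e_{3/2}(n), and a = 3/2 + j gives the moments                      *)
(*     E [1 - (k/n)^j] = (j e_{3/2}(j) / (j+1) + o(1)) B_n.                     *)
(* Expanding ln (3 - 2x) in powers of 2x/3 and summing the binomial series of   *)
(* (1 - 2/3)^(-1/2), the mean of ln (3 - 2k/n) is (beta + o(1)) B_n with        *)
(* beta = 3 sqrt 3 - 4 = 2 - gamma. So ln (3 - 2k/n) - beta (H(n) - H(k)) has   *)
(* mean o(B_n) and second moment O(B_n); summing along the chain, the second    *)
(* moment of its total is o((ln n)^2), and Chebyshev's inequality concludes.    *)

(* The bridge between trees and the chain is [treeavg_spine]: given their sizes, the two subtrees of
   the root are independent and uniform, so averaging a quantity that splits at the root with
   weights [growthC] amounts to one step of the chain ([growthC_step], [treecountE]). Hence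
   [log_dev], the centred logarithm of the weight of a leaf, accumulates one [spine_incr] per step.

   [spine_mean_incr] and [spine_mean_incr_sqr] control a single step. To sum over the steps, [harm]
   serves as a clock: its mean decrement is exactly B_n, so a cost of at most eps B_n per step
   totals at most eps [harm n] ([spine_first_moment], [spine_second_moment]). Chebyshev's inequality
   is [treeavg_atypical].

   All three claims reduce to it through [unif_prob_atypical]. Typical leaves carry almost all the
   mass; as the total mass is one, at most n^(gamma+eps) leaves weigh n^(-gamma-eps) or more
   ([card_heavy_leaves]); and n^(gamma-eps) leaves have little mass among the typical ones
   ([leaf_measure_few_leaves]). *)
Require Import Defs.
From HB Require Import structures.
From mathcomp Require Import all_boot all_order all_algebra.
From mathcomp Require Import all_classical reals topology normedtype exp.
From mathcomp Require Import sequences derive realfun.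
From mathcomp Require Import ring lra.
Import Order.TTheory GRing.Theory Num.Theory.
Import numFieldNormedType.Exports.

Set Implicit Arguments.
Unset Strict Implicit.
Unset Printing Implicit Defensive.

Local Open Scope classical_set_scope.
Local Open Scope ring_scope.

(* [mathcomp.boot.tuple] has a [tsize] too. *)
Local Notation tsize := Defs.tsize.

(** * Negative binomial coefficients *)

Section NegativeBinomial.
Variable R : realFieldType.
Implicit Types a b : R.

(** This is e_a(n): the rising factorial a(a+1)...(a+n-1) divided by n!. *)
Fixpoint negbin a n : R :=
  if n is m.+1 then negbin a m * (a + m%:R) / m.+1%:R else 1.

(** Coefficientwise form of the fact that (1 - x)^(-a) has derivative a (1 - x)^(-a-1). *)
Lemma negbin_absorb a n : n.+1%:R * negbin a n.+1 = a * negbin (a + 1) n.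
Proof.
elim: n => [|n IHn]; first by rewrite /= mul1r divr1 addr0 mulr1 mul1r.
have n1 : n.+1%:R != 0 :> R by rewrite pnatr_eq0.
have n2 : n.+2%:R != 0 :> R by rewrite pnatr_eq0.
apply: (mulfI n1); rewrite [negbin (a + 1) _]/= [negbin a _]/= -/(negbin a n.+1).
transitivity (n.+1%:R * negbin a n.+1 * (a + n.+1%:R)).
  by move: n2 (negbin a n.+1); move: (n.+2%:R : R) => N n2 e; field.
by rewrite IHn -natr1; move: n1; rewrite -natr1 => n1; field.
Qed.

Lemma negbin_gt0 a n : 0 < a -> 0 < negbin a n.
Proof.
move=> a0; elim: n => //= n IHn.
by rewrite divr_gt0 ?ltr0n// mulr_gt0// ltr_wpDr.
Qed.

Lemma negbin1 n : negbin 1 n = 1.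
Proof.
elim: n => //= n ->; rewrite mul1r addrC natr1 divff//.
by rewrite pnatr_eq0.
Qed.

(** Both sides are a(a+1)...(a+j+k-1) / (j! k!). This trades the index of a coefficient for its
    parameter. *)
Lemma negbin_sym a j k :
  negbin (a + j%:R) k * negbin a j = negbin (a + k%:R) j * negbin a k.
Proof.
elim: j => [|j IHj]; first by rewrite /= addr0 mulr1 mul1r.
suff E : negbin (a + j.+1%:R) k * (a + j%:R) =
         negbin (a + j%:R) k * (a + k%:R + j%:R).
  rewrite /= !mulrA mulrAC [LHS]mulrAC.
  transitivity (negbin (a + j.+1%:R) k * (a + j%:R) * negbin a j / j.+1%:R).
    by ring.
  rewrite E; transitivity ((negbin (a + j%:R) k * negbin a j) *
     (a + k%:R + j%:R) / j.+1%:R); first by ring.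
  by rewrite IHj; ring.
have k1 : k.+1%:R != 0 :> R by rewrite pnatr_eq0.
rewrite -natr1 addrA mulrC -negbin_absorb /=.
by move: k1; move: (k.+1%:R : R) => K K0; field.
Qed.

Definition conv (f g : nat -> R) n := \sum_(k < n.+1) f k * g (n - k)%N.

Lemma conv_weightl f g n :
  conv (fun k => k%:R * f k) g n.+1 = conv (fun k => k.+1%:R * f k.+1) g n.
Proof.
rewrite /conv big_ord_recl /= !mul0r add0r.
by apply: eq_bigr => i _; rewrite /bump /= add1n subSS.
Qed.

Lemma convC f g n : conv f g n = conv g f n.
Proof.
rewrite /conv (reindex_inj rev_ord_inj) /=; apply: eq_bigr => i _.
by rewrite mulrC subSS subKn// -ltnS.
Qed.

Lemma conv_weightr f g n :
  conv f (fun k => k%:R * g k) n.+1 = conv f (fun k => k.+1%:R * g k.+1) n.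
Proof. by rewrite convC conv_weightl convC. Qed.

Lemma conv_weight f g n :
  n%:R * conv f g n = conv (fun k => k%:R * f k) g n + conv f (fun k => k%:R * g k) n.
Proof.
rewrite /conv -big_split /= mulr_sumr; apply: eq_bigr => i _.
have -> : n%:R = i%:R + (n - i)%:R :> R by rewrite -natrD subnKC// -ltnS.
by ring.
Qed.

Lemma convZl c f g n : conv (fun k => c * f k) g n = c * conv f g n.
Proof. by rewrite /conv mulr_sumr; apply: eq_bigr => i _; rewrite mulrA. Qed.

Lemma convZr c f g n : conv f (fun k => c * g k) n = c * conv f g n.
Proof. by rewrite convC convZl convC. Qed.

Lemma convDl f1 f2 g n :
  conv (fun k => f1 k + f2 k) g n = conv f1 g n + conv f2 g n.
Proof. by rewrite /conv -big_split; apply: eq_bigr => i _; rewrite mulrDl. Qed.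

Lemma eq_conv f1 f2 g1 g2 n : f1 =1 f2 -> g1 =1 g2 -> conv f1 g1 n = conv f2 g2 n.
Proof. by move=> ef eg; apply: eq_bigr => i _; rewrite ef eg. Qed.

(** Vandermonde's identity. Multiplying by n+1 and applying the Leibniz rule [conv_weight] raises
    one parameter by 1 in each term, so the induction on n must keep a and b general. *)
Lemma conv_negbin a b n : conv (negbin a) (negbin b) n = negbin (a + b) n.
Proof.
elim: n a b => [|n IHn] a b; first by rewrite /conv big_ord1 /= mulr1.
apply: (@mulfI _ n.+1%:R); first by rewrite pnatr_eq0.
rewrite conv_weight conv_weightl conv_weightr.
rewrite (eq_conv n (negbin_absorb a) (frefl _)) (eq_conv n (frefl _) (negbin_absorb b)).
rewrite convZl convZr !IHn negbin_absorb mulrDl.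
by rewrite (_ : a + 1 + b = a + b + 1) ?addrA//; ring.
Qed.

(* The derivative of [negbin a n] with respect to [a]. *)
Definition dnegbin a n := negbin a n * \sum_(i < n) (a + i%:R)^-1.

Lemma dnegbin_absorb a n : 0 < a ->
  n.+1%:R * dnegbin a n.+1 = a * dnegbin (a + 1) n + negbin (a + 1) n.
Proof.
move=> a0; rewrite /dnegbin mulrA negbin_absorb big_ord_recl /= addr0.
rewrite (eq_bigr (fun i : 'I_n => (a + 1 + i%:R)^-1)); last first.
  by move=> i _; rewrite /bump /= add1n -natr1 addrAC addrA.
by field; rewrite gt_eqF.
Qed.

(** The derivative in a of [conv_negbin], proved by the same induction. Positivity keeps the
    inverses in [dnegbin] genuine, while b itself may be negative, as for -1/2. *)
Lemma conv_dnegbin a b n : 0 < a -> 0 < a + b ->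
  conv (dnegbin a) (negbin b) n = dnegbin (a + b) n.
Proof.
elim: n a b => [|n IHn] a b a0 ab0.
  by rewrite /conv big_ord1 /dnegbin !big_ord0 /= !mulr0 mul0r.
apply: (@mulfI _ n.+1%:R); first by rewrite pnatr_eq0.
rewrite conv_weight conv_weightl conv_weightr.
rewrite (eq_conv n (fun k => dnegbin_absorb k a0) (frefl _)).
rewrite (eq_conv n (frefl _) (negbin_absorb b)).
rewrite convDl convZl convZr conv_negbin dnegbin_absorb//.
have e1 : a + 1 + b = a + b + 1 by ring.
have e2 : a + (b + 1) = a + b + 1 by ring.
have a1 : 0 < a + 1 by rewrite ltr_wpDr.
have ab1 : 0 < a + b + 1 by rewrite ltr_wpDr.
by rewrite !IHn ?e1 ?e2//; ring.
Qed.

(** Here 3n - 2k = k + 3(n - k), whence the factor a + 3b in the identities below, which vanishes at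
    (3/2, -1/2). *)
Lemma conv_affine (f g : nat -> R) n :
  \sum_(k < n.+1) f k * g (n - k)%N * (3 * n%:R - 2 * k%:R) =
  conv (fun k => k%:R * f k) g n + 3 * conv f (fun k => k%:R * g k) n.
Proof.
have -> : \sum_(k < n.+1) f k * g (n - k)%N * (3 * n%:R - 2 * k%:R) =
    3 * (n%:R * conv f g n) - 2 * conv (fun k => k%:R * f k) g n.
  by rewrite /conv !mulr_sumr -sumrB; apply: eq_bigr => i _; ring.
by rewrite conv_weight; ring.
Qed.

Lemma negbin_affine a b n :
  \sum_(k < n.+2) negbin a k * negbin b (n.+1 - k)%N * (3 * n.+1%:R - 2 * k%:R) =
  (a + 3 * b) * negbin (a + b + 1) n.
Proof.
rewrite conv_affine conv_weightl conv_weightr.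
rewrite (eq_conv n (negbin_absorb a) (frefl _)) (eq_conv n (frefl _) (negbin_absorb b)).
have e1 : a + 1 + b = a + b + 1 by ring.
by rewrite convZl convZr !conv_negbin e1 addrA; ring.
Qed.

Lemma dnegbin_affine a b n : 0 < a -> 0 < a + b ->
  \sum_(k < n.+2) dnegbin a k * negbin b (n.+1 - k)%N * (3 * n.+1%:R - 2 * k%:R) =
  (a + 3 * b) * dnegbin (a + b + 1) n + negbin (a + b + 1) n.
Proof.
move=> a0 ab0; rewrite conv_affine conv_weightl conv_weightr.
rewrite (eq_conv n (fun k => dnegbin_absorb k a0) (frefl _)).
rewrite (eq_conv n (frefl _) (negbin_absorb b)).
have e1 : a + 1 + b = a + b + 1 by ring.
have e2 : a + (b + 1) = a + b + 1 by ring.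
have a1 : 0 < a + 1 by rewrite ltr_wpDr.
have ab1 : 0 < a + b + 1 by rewrite ltr_wpDr.
by rewrite convDl convZl convZr !conv_negbin !conv_dnegbin ?e1 ?e2//; ring.
Qed.

Lemma negbin_n0 a : negbin a 0 = 1. Proof. by []. Qed.

Lemma negbin_n1 a : negbin a 1 = a.
Proof. by rewrite /= mul1r addr0 divr1. Qed.

Lemma negbinS a n : negbin a n.+1 = negbin a n * (a + n%:R) / n.+1%:R.
Proof. by []. Qed.

End NegativeBinomial.

Arguments negbin : simpl never.

(** * The chain of subtree sizes *)

Section SpineChain.
Variable R : realFieldType.
Implicit Types (a b : R) (f g : nat -> R).

Local Notation e32 := (@negbin R (3 / 2)).

Definition spine_step n k : R :=
  e32 k * - negbin (- (1 / 2)) (n - k)%N * (3 * n%:R - 2 * k%:R) / (n%:R * e32 n).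

Definition spine_mean n g := \sum_(k < n) spine_step n k * g k.

Definition spine_drift n : R := (e32 n)^-1.

Definition harm n : R := \sum_(i < n) (3 / 2 + i%:R)^-1.

Lemma e32_gt0 n : 0 < e32 n. Proof. by apply: negbin_gt0; lra. Qed.

Lemma e32_neq0 n : e32 n != 0. Proof. by rewrite gt_eqF ?e32_gt0. Qed.

Lemma spine_drift_gt0 n : 0 < spine_drift n.
Proof. by rewrite invr_gt0 e32_gt0. Qed.

Lemma negbin_Nhalf_lt0 n : negbin (- (1 / 2) : R) n.+1 < 0.
Proof.
have n0 : 0 < n.+1%:R :> R by rewrite ltr0n.
rewrite -(pmulr_rlt0 _ n0) negbin_absorb.
have h : 0 < negbin (- (1 / 2) + 1 : R) n by apply: negbin_gt0; lra.
by rewrite pmulr_llt0//; lra.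
Qed.

Lemma spine_step_ge0 n k : (k < n)%N -> 0 <= spine_step n k.
Proof.
move=> kn; rewrite /spine_step divr_ge0//; last by rewrite mulr_ge0// ltW ?e32_gt0.
rewrite mulr_ge0//; last first.
  have : k%:R <= n%:R :> R by rewrite ler_nat ltnW.
  by have := ler0n R k; lra.
rewrite mulr_ge0 ?(ltW (e32_gt0 _))// oppr_ge0.
by move: kn; rewrite -subn_gt0; case: (n - k)%N => // m _; exact/ltW/negbin_Nhalf_lt0.
Qed.

(** The chain stops at k = n, whereas the convolution includes k = n+1. That term equals (n+1)
    f(n+1), since e_b(0) = 1, and accounts for the first summand on the right. Dividing f by [e32]
    cancels the factor [e32 k] of the step. *)
Lemma spine_mean_affine n f : spine_mean n.+1 (fun k => f k / e32 k) =
  f n.+1 / e32 n.+1 -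
  (\sum_(k < n.+2) f k * negbin (- (1 / 2)) (n.+1 - k)%N *
     (3 * n.+1%:R - 2 * k%:R)) / (n.+1%:R * e32 n.+1).
Proof.
rewrite big_ord_recr /= subnn negbin_n0 mulr1 [X in _ - X]mulrDl opprD addrCA.
have n0 : n.+1%:R != 0 :> R by rewrite pnatr_eq0.
have en := e32_neq0 n.+1.
rewrite -mulNr -sumrN mulr_suml.
rewrite (_ : f n.+1 / _ - _ = 0) ?addr0.
  apply: eq_bigr => k _; rewrite /spine_step; have ek := e32_neq0 k.
  move: en n0 ek; set N : R := n.+1%:R; move: N (e32 n.+1) (e32 k) => N x y x0 N0 y0.
  by field; rewrite x0 N0 y0.
move: en n0; set N : R := n.+1%:R; move: N (e32 n.+1) => N x x0 N0.
by field; rewrite x0 N0.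
Qed.

Lemma spine_mean_negbin a n :
  spine_mean n.+1 (fun k => negbin a k / e32 k) =
  negbin a n.+1 / e32 n.+1 -
  (a - 3 / 2) * negbin (a + 1 / 2) n / (n.+1%:R * e32 n.+1).
Proof.
rewrite spine_mean_affine negbin_affine; congr (_ - _ * _ / _); first by lra.
by congr (negbin _ _); lra.
Qed.

Lemma eq_spine_mean n f g : (forall k, (k < n)%N -> f k = g k) ->
  spine_mean n f = spine_mean n g.
Proof. by move=> fg; apply: eq_bigr => k _; rewrite fg. Qed.

Lemma spine_mean1 n : spine_mean n.+1 (fun=> 1) = 1.
Proof.
rewrite -[RHS](divff (e32_neq0 n.+1)).
have -> : spine_mean n.+1 (fun=> 1) = spine_mean n.+1 (fun k => e32 k / e32 k).
  by apply: eq_spine_mean => k _; rewrite divff ?e32_neq0.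
by rewrite spine_mean_negbin subrr !mul0r subr0.
Qed.

Lemma negbin_half k : negbin (1 / 2) k * (2 * k%:R + 1) = e32 k.
Proof.
have := negbin_sym (1 / 2 : R) 1 k; rewrite !negbin_n1.
by rewrite (_ : 1 / 2 + 1 = 3 / 2); lra.
Qed.

(** The case a = 1/2, where e_{1/2}(k) / e_{3/2}(k) = 1 / (2k+1). It yields the second moment bound
    [spine_mean_harm_sqr]. *)
Lemma spine_mean_inv n :
  spine_mean n.+1 (fun k => (2 * k%:R + 1)^-1) =
  (2 * n.+1%:R + 1)^-1 + spine_drift n.+1 / n.+1%:R.
Proof.
have E k : (2 * k%:R + 1)^-1 = negbin (1 / 2) k / e32 k.
  rewrite -[LHS]mul1r; apply/eqP; rewrite eqr_div ?e32_neq0//; last first.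
    by have := ler0n R k; lra.
  by rewrite negbin_half mul1r.
rewrite E (eq_spine_mean (fun k _ => E k)) spine_mean_negbin.
rewrite (_ : 1 / 2 + 1 / 2 = 1) ?negbin1; last by lra.
congr (_ + _); rewrite /spine_drift invfM.
by move: (e32 n.+1)^-1 (n.+1%:R^-1 : R) => u v; field.
Qed.

Lemma harmE k : dnegbin (3 / 2) k / e32 k = harm k.
Proof. by rewrite /dnegbin mulrAC divff ?e32_neq0// mul1r. Qed.

(** In [dnegbin_affine] at (3/2, -1/2) the coefficient a + 3b vanishes; only e_2(n) = n+1 survives,
    and it cancels against the normalisation of the step. *)
Lemma spine_mean_harm n : spine_mean n.+1 harm = harm n.+1 - spine_drift n.+1.
Proof.
rewrite (eq_spine_mean (fun k _ => esym (harmE k))) spine_mean_affine harmE.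
rewrite dnegbin_affine; [|lra|lra].
rewrite (_ : 3 / 2 + 3 * - (1 / 2) = 0) ?mul0r ?add0r; last by lra.
congr (_ - _); rewrite (_ : 3 / 2 - 1 / 2 + 1 = 1 + 1%:R); last by lra.
have := negbin_sym (1 : R) 1 n; rewrite !negbin1 !negbin_n1 !mulr1.
move=> ->; rewrite addrC natr1 /spine_drift.
have n0 : n.+1%:R != 0 :> R by rewrite pnatr_eq0.
by rewrite invfM mulrA divff// mul1r.
Qed.

Lemma negbin_shiftE j k : negbin (3 / 2 + j%:R) k / e32 k =
  negbin (3 / 2 + k%:R) j / e32 j.
Proof.
by apply/eqP; rewrite eqr_div ?e32_neq0// negbin_sym.
Qed.

(** The case a = 3/2 + j. By [negbin_shiftE] the averaged function is, up to a constant, a rising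
    factorial of length j in k, an exactly solvable substitute for the power k^j. *)
Lemma spine_mean_rising j n :
  spine_mean n.+1 (fun k => negbin (3 / 2 + k%:R) j / negbin (3 / 2 + n.+1%:R) j) =
  1 - spine_drift n.+1 * (j%:R * e32 j / j.+1%:R) *
      (negbin (n.+1%:R + 1) j / negbin (3 / 2 + n.+1%:R) j).
Proof.
set q := negbin (3 / 2 + n.+1%:R) j.
have q0 : q != 0.
  by rewrite gt_eqF//; apply: negbin_gt0; have := ler0n R n.+1; lra.
have -> : spine_mean n.+1 (fun k => negbin (3 / 2 + k%:R) j / q) =
    e32 j / q * spine_mean n.+1 (fun k => negbin (3 / 2 + j%:R) k / e32 k).
  rewrite /spine_mean mulr_sumr; apply: eq_bigr => k _; rewrite negbin_shiftE.
  have := e32_neq0 j; move: (spine_step _ _) (e32 j) (negbin _ _) q0 => s x y x0 y0.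
  by field; rewrite x0 y0.
rewrite spine_mean_negbin negbin_shiftE -/q.
have -> : negbin (3 / 2 + j%:R + 1 / 2) n = n.+1%:R / j.+1%:R * negbin (n.+1%:R + 1 : R) j.
  have := negbin_sym (1 : R) j.+1 n; rewrite !negbin1 !mulr1.
  have -> : 1 + j.+1%:R = 3 / 2 + j%:R + 1 / 2 :> R by rewrite -natr1; lra.
  move=> ->; rewrite (_ : 1 + n%:R = n.+1%:R); last by rewrite addrC natr1.
  have J0 : j.+1%:R != 0 :> R by rewrite pnatr_eq0.
  apply: (mulfI J0); rewrite negbin_absorb.
  by move: (j.+1%:R : R) J0 => J J0; field; rewrite J0.
rewrite /spine_drift (_ : 3 / 2 + j%:R - 3 / 2 = j%:R :> R); last by lra.
have J0 : j.+1%:R != 0 :> R by rewrite pnatr_eq0.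
have n0 : n.+1%:R != 0 :> R by rewrite pnatr_eq0.
have := e32_neq0 j; have := e32_neq0 n.+1.
move: (e32 j) (e32 n.+1) (negbin _ _) q q0 J0 n0 => x y u q q0.
move: (j.+1%:R : R) (n.+1%:R : R) (j%:R : R) => J N j' J0 N0 y0 x0.
by field; rewrite J0 N0 x0 y0 q0.
Qed.

Lemma spine_meanD n f g :
  spine_mean n (fun k => f k + g k) = spine_mean n f + spine_mean n g.
Proof. by rewrite /spine_mean -big_split; apply: eq_bigr => k _; rewrite mulrDr. Qed.

Lemma spine_meanZ n c f : spine_mean n (fun k => c * f k) = c * spine_mean n f.
Proof. by rewrite /spine_mean mulr_sumr; apply: eq_bigr => k _; rewrite mulrCA. Qed.

Lemma spine_meanB n f g :
  spine_mean n (fun k => f k - g k) = spine_mean n f - spine_mean n g.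
Proof. by rewrite /spine_mean -sumrB; apply: eq_bigr => k _; rewrite mulrBr. Qed.

Lemma spine_mean_cst n c : spine_mean n.+1 (fun=> c) = c.
Proof.
by have := spine_meanZ n.+1 c (fun=> 1); rewrite spine_mean1 mulr1.
Qed.

Lemma ler_spine_mean n f g : (forall k, (k < n)%N -> f k <= g k) ->
  spine_mean n f <= spine_mean n g.
Proof.
by move=> fg; apply: ler_sum => k _; rewrite ler_wpM2l ?fg// spine_step_ge0.
Qed.

Lemma ler_norm_spine_mean n f : `|spine_mean n f| <= spine_mean n (fun k => `|f k|).
Proof.
apply: (le_trans (ler_norm_sum _ _ _)); apply: ler_sum => k _.
by rewrite normrM ger0_norm// spine_step_ge0.
Qed.

Lemma spine_mean_harmB n :
  spine_mean n.+1 (fun k => harm n.+1 - harm k) = spine_drift n.+1.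
Proof. by rewrite spine_meanB spine_mean_cst spine_mean_harm; lra. Qed.

Lemma harm_ge0 n : 0 <= harm n.
Proof. by apply: sumr_ge0 => i _; rewrite invr_ge0; have := ler0n R i; lra. Qed.

Lemma harmS n : harm n.+1 = harm n + (3 / 2 + n%:R)^-1.
Proof. by rewrite /harm big_ord_recr. Qed.

Lemma harm_mono (k n : nat) : (k <= n)%N -> harm k <= harm n.
Proof.
move=> kn; rewrite -(subnKC kn); elim: (n - k)%N => [|d IHd]; first by rewrite addn0.
rewrite addnS harmS (le_trans IHd)// lerDl invr_ge0.
by have := ler0n R (k + d)%N; lra.
Qed.

(** The difference has n - k terms, the smallest being 1 / (n + 1/2). *)
Lemma harm_ge (k n : nat) : (k <= n)%N ->
  (n%:R - k%:R) / (n%:R + 1 / 2) <= harm n - harm k.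
Proof.
move=> kn; rewrite ler_pdivrMr; last by have := ler0n R n; lra.
rewrite -(subnKC kn); elim: (n - k)%N => [|d IHd]; first by rewrite addn0 !subrr mul0r.
have := harm_mono (leq_addr d k); move: IHd; rewrite addnS harmS -[(k + d).+1%:R]natr1.
have := ler0n R (k + d)%N; move: ((k + d)%:R : R) => m m0 IHd kd.
have -> : (harm (k + d)%N + (3 / 2 + m)^-1 - harm k) * (m + 1 + 1 / 2) =
  (harm (k + d)%N - harm k) * (m + 1 / 2) + (harm (k + d)%N - harm k) + 1.
  by field; lra.
lra.
Qed.

Lemma gap_le_harm (k n : nat) : (k <= n.+1)%N ->
  1 - k%:R / n.+1%:R <= 3 / 2 * (harm n.+1 - harm k).
Proof.
move=> kn; have := harm_ge kn.
have n0 : 1 <= n.+1%:R :> R by rewrite ler1n.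
have k0 : k%:R <= n.+1%:R :> R by rewrite ler_nat.
set N : R := n.+1%:R in n0 k0 *; set K : R := k%:R in k0 *.
move=> h; apply: le_trans (ler_wpM2l _ h); last by lra.
rewrite mulrA ler_pdivlMr; last by lra.
have -> : (1 - K / N) = (N - K) / N by field; lra.
rewrite mulrAC ler_pdivrMr; last by lra.
(* This is N + 1/2 <= (3/2) N, valid since N >= 1; hence the constant 3/2. *)
nra.
Qed.

End SpineChain.

(** * The constant beta *)

Section DriftConstant.
Variable R : realType.
Implicit Types (x eps : R) (n k j J : nat).

Local Notation z := (2 / 3 : R).
Local Notation e32 := (@negbin R (3 / 2)).

Definition beta : R := 3 * Num.sqrt 3 - 4.

Definition half_sum J : R := \sum_(m < J) negbin (1 / 2) m * z ^+ m.

Lemma sum_geom J : \sum_(m < J) z ^+ m = 3 * (1 - z ^+ J).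
Proof.
have := subrX1 z J; set S := \sum_(_ < _) _.
by rewrite (_ : z - 1 = - (1 / 3)); [lra | lra].
Qed.

(* The coefficients of the square are partial convolutions of [negbin (1/2)] *)
(* with itself, hence at most [negbin 1 = 1], with equality in degree < J.   *)
Lemma half_sum_sqr J : 3 * (1 - z ^+ J) <= half_sum J ^+ 2 <= 3.
Proof.
pose p := \poly_(i < J) negbin (1 / 2 : R) i.
have hp0 m : 0 <= negbin (1 / 2 : R) m by apply/ltW/negbin_gt0; lra.
have pE : p.[z] = half_sum J.
  rewrite (@horner_coef_wide _ J) ?size_poly//.
  by apply: eq_bigr => i _; rewrite coef_poly ltn_ord.
have ppE : (p * p).[z] = half_sum J ^+ 2 by rewrite hornerM pE expr2.
have zi i : 0 <= z ^+ i by rewrite exprn_ge0//; lra.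
have conv1 i : \sum_(j < i.+1) negbin (1 / 2 : R) j * negbin (1 / 2) (i - j)%N = 1.
  have := conv_negbin (1 / 2 : R) (1 / 2) i.
  by rewrite /conv (_ : 1 / 2 + 1 / 2 = 1) ?negbin1//; lra.
have c0 i : 0 <= (p * p)`_i.
  rewrite coefM sumr_ge0// => j _; rewrite mulr_ge0// coef_poly; by case: ifP.
have c1 i : (p * p)`_i <= 1.
  rewrite coefM -(conv1 i); apply: ler_sum => j _; rewrite !coef_poly.
  by case: ifP => _; case: ifP => _; rewrite ?mulr0 ?mul0r ?mulr_ge0.
have c2 i : (i < J)%N -> (p * p)`_i = 1.
  move=> iJ; rewrite coefM -(conv1 i); apply: eq_bigr => j _; rewrite !coef_poly.
  by rewrite !(leq_ltn_trans _ iJ) ?leq_subr// -ltnS.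
have spp : (size (p * p)%R <= J + J)%N.
  apply: (leq_trans (size_polyMleq _ _)); apply: leq_trans (leq_pred _) _.
  by rewrite leq_add ?size_poly.
rewrite -ppE (horner_coef_wide _ spp); apply/andP; split.
  rewrite big_split_ord /= -sum_geom -[leLHS]addr0 lerD//.
    by apply: ler_sum => i _; rewrite c2// mul1r.
  by apply: sumr_ge0 => i _; rewrite mulr_ge0.
apply: (@le_trans _ _ (3 * (1 - z ^+ (J + J)))).
  rewrite -sum_geom; apply: ler_sum => i _; rewrite -[leRHS]mul1r.
  by rewrite ler_wpM2r.
by have := zi (J + J)%N; lra.
Qed.

(** The difference of squares is divided by the sum of the two numbers, which is at least 1: with
    J.+1 terms the leading term 1 is present. *)
Lemma half_sum_sqrt J : `|half_sum J.+1 - Num.sqrt 3| <= 3 * z ^+ J.+1.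
Proof.
have := half_sum_sqr J.+1.
have : 1 <= half_sum J.+1.
  rewrite /half_sum big_ord_recl /= expr0 mulr1 negbin_n0 lerDl.
  by apply: sumr_ge0 => i _; rewrite mulr_ge0 ?exprn_ge0//; [apply/ltW/negbin_gt0; lra | lra].
have := sqr_sqrtr (ler0n R 3); have := sqrtr_ge0 (3 : R).
set s := half_sum _; set r := Num.sqrt 3; set q := z ^+ _ => r0 r2 s1 /andP[h1 h2].
have q0 : 0 <= q by rewrite exprn_ge0//; lra.
have : (s - r) * (s + r) <= 0 by nra.
have : - (3 * q) <= (s - r) * (s + r) by nra.
move=> h3 h4; rewrite ler_norml; apply/andP; split; nra.
Qed.

(** The coefficient z^j / j of the logarithmic series, times the constant of the j-th moment of the
    chain, for j from 1 to J. *)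
Definition drift_sum J : R :=
  \sum_(j < J) z ^+ j.+1 / j.+1%:R * (j.+1%:R * e32 j.+1 / j.+2%:R).

(** By absorption, the j-th term of the drift is 3 times the term of index j+1 of the binomial
    series. The two missing terms of that series, 1 and 1/3, account for the 4. *)
Lemma drift_sumE J : drift_sum J = 3 * half_sum J.+2 - 4.
Proof.
rewrite /half_sum !big_ord_recl /= expr0 negbin_n0 mulr1 negbin_n1 expr1.
set S := \sum_(_ < _) _.
suff -> : drift_sum J = 3 * S by lra.
rewrite /S mulr_sumr; apply: eq_bigr => j _; rewrite /bump /= !add1n.
have := negbin_absorb (1 / 2 : R) j.+1; rewrite (_ : 1 / 2 + 1 = 3 / 2); last by lra.
rewrite !exprS; move: (z ^+ j) (negbin (1 / 2) j.+2) (e32 j.+1) => w u v.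
have J0 : j.+1%:R != 0 :> R by rewrite pnatr_eq0.
have J1 : j.+2%:R != 0 :> R by rewrite pnatr_eq0.
move: (j.+1%:R : R) (j.+2%:R : R) J0 J1 => a b a0 b0 h.
have -> : v = 2 * (b * u) by rewrite h; field.
by field; rewrite a0 b0.
Qed.

Lemma drift_sum_beta J : `|drift_sum J - beta| <= 9 * z ^+ J.
Proof.
rewrite drift_sumE /beta (_ : _ - _ = 3 * (half_sum J.+2 - Num.sqrt 3)); last by ring.
rewrite normrM ger0_norm; last by lra.
have zJ : 0 <= z ^+ J by rewrite exprn_ge0//; lra.
have := half_sum_sqrt J.+1; rewrite !exprS; nra.
Qed.

(** Truncation of the power series of - ln (1 - 2x/3). *)
Definition logpoly J x : R := \sum_(j < J) z ^+ j.+1 * x ^+ j.+1 / j.+1%:R.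

Lemma is_derive_logpoly J x :
  is_derive x 1 (logpoly J) (\sum_(j < J) z ^+ j.+1 * x ^+ j).
Proof.
elim: J => [|J IHJ].
  rewrite big_ord0 (_ : logpoly 0 = cst 0); first exact: is_derive_cst.
  by apply/funext => y; rewrite /logpoly big_ord0.
rewrite big_ord_recr /=.
have -> : logpoly J.+1 =
    logpoly J + ((z ^+ J.+1 / J.+1%:R) \*: ((@id R : R -> R) ^+ J.+1)).
  apply/funext => y; rewrite /logpoly big_ord_recr /=; congr (_ + _).
  by rewrite exprfctE /= mulrAC.
apply: is_deriveD; apply: is_derive_eq.
rewrite /= [_ *: 1]mulr1 /GRing.scale /= mulrA divfK//.
by rewrite pnatr_eq0.
Qed.

(** As ln (3 - 2x) = ln (1 - 2x/3) - ln (1 - 2/3), only the truncation error matters. The mean value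
    theorem on [x, 1] yields the factor 1 - x, which is essential: averaged over a step of the
    chain, it makes the error a small multiple of B_n. *)
Lemma logpoly_approx J x : 0 <= x <= 1 ->
  `|ln (3 - 2 * x) - (logpoly J 1 - logpoly J x)| <= 3 * z ^+ J * (1 - x).
Proof.
move=> /andP[x0 x1].
pose D (y : R) := ln (3 - 2 * y) + logpoly J y.
have dD (y : R) : y <= 1 -> is_derive y 1 D
    (- 2 * (3 - 2 * y)^-1 + \sum_(j < J) z ^+ j.+1 * y ^+ j).
  move=> y1; apply: is_deriveD; last exact: is_derive_logpoly.
  have l0 : 0 < 3 - 2 * y by lra.
  have dl : is_derive y 1 (fun y : R => 3 - 2 * y) (- 2).
    by apply: is_derive_eq; rewrite add0r mul1r /GRing.scale /= mulr1.
  have dln := @is_derive1_comp R (@ln R) (fun y => 3 - 2 * y) y _ _ (is_derive1_ln l0) dl.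
  by apply: (is_derive_eq dln); rewrite mulrC.
have [c /[!in_itv]/= /andP[xc c1]] : exists2 c, c \in `[x, 1] &
    D 1 - D x = (- 2 * (3 - 2 * c)^-1 + \sum_(j < J) z ^+ j.+1 * c ^+ j) * (1 - x).
  apply: MVT_segment => //.
    by move=> y /[!in_itv]/= /andP[_ /ltW y1]; exact: dD.
  apply: derivable_within_continuous => y /[!in_itv]/= /andP[_ y1].
  by have := dD y y1; case.
rewrite (_ : \sum_(j < J) _ = z * (1 - (z * c) ^+ J) / (1 - z * c)); last first.
  have h : 1 - z * c != 0 by lra.
  apply/eqP; rewrite eq_sym -[X in _ == X](mulfK h); apply/eqP; congr (_ / _).
  rewrite -opprB subrX1 -mulNr opprB mulrCA mulrC; congr (_ * _).
  by rewrite mulr_sumr; apply: eq_bigr => j _; rewrite exprMn exprS mulrA.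
have -> : - 2 * (3 - 2 * c)^-1 + z * (1 - (z * c) ^+ J) / (1 - z * c) =
  - (2 * (z * c) ^+ J / (3 - 2 * c)).
  by move: ((z * c) ^+ J) => w; field; lra.
rewrite /D mulr1 (_ : 3 - 2 = 1) ?ln1 ?add0r; last by lra.
move=> h; have -> : ln (3 - 2 * x) - (logpoly J 1 - logpoly J x) =
  2 * (z * c) ^+ J / (3 - 2 * c) * (1 - x) by move: h; lra.
rewrite normrM [X in _ * X]ger0_norm ?subr_ge0// ler_wpM2r ?subr_ge0//.
have w0 : 0 <= (z * c) ^+ J by rewrite exprn_ge0//; lra.
have : (z * c) ^+ J <= z ^+ J by rewrite lerXn2r ?nnegrE//; lra.
move: w0; move: (_ ^+ J) (_ ^+ J) => w v w0 wv.
rewrite ger0_norm; last by rewrite divr_ge0//; lra.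
rewrite ler_pdivrMr; last by lra.
nra.
Qed.

End DriftConstant.

(** * Mean and second moment of one step of the chain *)

Section SpineDrift.
Variable R : realType.
Implicit Types (x eps : R) (n k j J : nat).

Local Notation z := (2 / 3 : R).
Local Notation e32 := (@negbin R (3 / 2)).
Local Notation B := (@spine_drift R).
Local Notation harm := (@harm R).

(** Replaces rising factorials by powers. The error keeps a factor 1 - k/n, of mean O(B_n), besides
    the 1/n, so that it is negligible against B_n. *)
Lemma rising_ratio_approx j : exists2 K : R, 0 <= K & forall n k, (k <= n.+1)%N ->
  `|negbin (3 / 2 + k%:R) j / negbin (3 / 2 + n.+1%:R) j - (k%:R / n.+1%:R) ^+ j|
    <= K / n.+1%:R * (1 - k%:R / n.+1%:R).
Proof.
elim: j => [|j [K K0 IHj]].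
  by exists 0 => // n k _; rewrite !negbin_n0 divff ?oner_eq0// expr0 subrr normr0 !mul0r.
exists (K + 3 / 2 + j%:R); first by have := ler0n R j; lra.
move=> n k kn; have := IHj n k kn; rewrite !negbinS exprS.
have n1 : 1 <= n.+1%:R :> R by rewrite ler1n.
have k0 : k%:R <= n.+1%:R :> R by rewrite ler_nat.
have k1 := ler0n R k; have j1 := ler0n R j.
have g0 : 0 <= negbin (3 / 2 + k%:R : R) j by apply/ltW/negbin_gt0; lra.
have h0 : 0 < negbin (3 / 2 + n.+1%:R : R) j by apply: negbin_gt0; lra.
have J0 : j.+1%:R != 0 :> R by rewrite pnatr_eq0.
set N : R := n.+1%:R in n1 k0 h0 *; set k' : R := k%:R in k0 k1 g0 *.
set j' : R := j%:R in j1 *.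
have -> : negbin (3 / 2 + k') j * (3 / 2 + k' + j') / j.+1%:R /
    (negbin (3 / 2 + N) j * (3 / 2 + N + j') / j.+1%:R) =
  negbin (3 / 2 + k') j / negbin (3 / 2 + N) j * ((3 / 2 + k' + j') / (3 / 2 + N + j')).
  move: (j.+1%:R : R) J0 (negbin _ _) (negbin _ _) h0 => J J0 u v v0.
  by field; rewrite J0 !gt_eqF//; lra.
set g := _ / negbin _ _; set x := k' / N; set f := (_ / (3 / 2 + N + j')).
move=> IH.
have x0 : 0 <= x by rewrite divr_ge0//; lra.
have x1 : x <= 1 by rewrite ler_pdivrMr; lra.
(* The new factor [f] of the ratio differs from x = k/n by an error of the required form. *)
have fx : 0 <= f - x <= (3 / 2 + j') / N * (1 - x).
  have -> : f - x = (3 / 2 + j') * (1 - x) / (3 / 2 + N + j').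
    by rewrite /f /x; field; lra.
  apply/andP; split; first by rewrite divr_ge0 ?mulr_ge0//; lra.
  rewrite mulrAC ler_wpM2r ?subr_ge0// ler_wpM2l//; first by lra.
  by rewrite lef_pV2 ?posrE; lra.
have f1 : f <= 1 by rewrite ler_pdivrMr; lra.
clearbody f g x.
have xj0 : 0 <= x ^+ j by rewrite exprn_ge0.
have xj1 : x ^+ j <= 1 by rewrite exprn_ile1.
have -> : g * f - x * x ^+ j = (g - x ^+ j) * f + x ^+ j * (f - x) by ring.
move: fx => /andP[fx0 fx1].
apply: (le_trans (ler_normD _ _)); rewrite !normrM (ger0_norm xj0) (ger0_norm fx0).
have f0 : 0 <= f by lra.
rewrite (ger0_norm f0) -addrA mulrDl mulrDl; apply: lerD.
  by apply: le_trans IH; rewrite ler_piMr.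
by apply: le_trans fx1; rewrite ler_piMl.
Qed.

Lemma rising_ratio_cvg j : exists2 K : R, 0 <= K & forall n,
  `|negbin (n.+1%:R + 1 : R) j / negbin (3 / 2 + n.+1%:R) j - 1| <= K / n.+1%:R.
Proof.
elim: j => [|j [K K0 IHj]].
  by exists 0 => // n; rewrite !negbin_n0 divff ?oner_eq0// subrr normr0 !mul0r.
exists (K + 1) => [|n]; first by lra.
have := IHj n; rewrite !negbinS.
have n1 : 1 <= n.+1%:R :> R by rewrite ler1n.
have j1 := ler0n R j.
have h0 : 0 < negbin (3 / 2 + n.+1%:R : R) j by apply: negbin_gt0; lra.
have J0 : j.+1%:R != 0 :> R by rewrite pnatr_eq0.
set N : R := n.+1%:R in n1 h0 *; set j' : R := j%:R in j1 *.
have -> : negbin (N + 1) j * (N + 1 + j') / j.+1%:R /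
    (negbin (3 / 2 + N) j * (3 / 2 + N + j') / j.+1%:R) =
  negbin (N + 1) j / negbin (3 / 2 + N) j * ((N + 1 + j') / (3 / 2 + N + j')).
  move: (j.+1%:R : R) J0 (negbin _ _) (negbin _ _) h0 => J J0 u v v0.
  by field; rewrite J0 !gt_eqF//; lra.
set g := _ / negbin _ _; set f := (_ / (3 / 2 + N + j')) => IH.
have fx : 0 <= 1 - f <= 1 / N.
  have -> : 1 - f = (1 / 2) / (3 / 2 + N + j') by rewrite /f; field; lra.
  apply/andP; split; first by rewrite divr_ge0//; lra.
  apply: ler_pM; [lra | by rewrite invr_ge0; lra | lra |].
  by rewrite lef_pV2 ?posrE; lra.
have f0 : 0 <= f by rewrite divr_ge0//; lra.
clearbody f g.
have -> : g * f - 1 = (g - 1) * f - (1 - f) by ring.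
move: fx => /andP[fx0 fx1].
apply: (le_trans (ler_normB _ _)); rewrite normrM (ger0_norm fx0) (ger0_norm f0).
rewrite mulrDl; apply: lerD => //.
by apply: le_trans IH; rewrite ler_piMr//; lra.
Qed.

Lemma spine_mean_gap n : spine_mean n.+1 (fun k => 1 - k%:R / n.+1%:R) <= 3 / 2 * B n.+1.
Proof.
rewrite -spine_mean_harmB -spine_meanZ; apply: ler_spine_mean => k kn.
exact/gap_le_harm/ltnW.
Qed.

Lemma spine_mean_pow j : exists2 K : R, 0 <= K & forall n,
  `|spine_mean n.+1 (fun k => 1 - (k%:R / n.+1%:R) ^+ j) -
    B n.+1 * (j%:R * e32 j / j.+1%:R)| <= K / n.+1%:R * B n.+1.
Proof.
have [K1 K10 h1] := rising_ratio_approx j; have [K2 K20 h2] := rising_ratio_cvg j.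
set c := j%:R * e32 j / j.+1%:R.
have c0 : 0 <= c by rewrite divr_ge0// mulr_ge0// ltW ?e32_gt0.
exists (K1 * (3 / 2) + c * K2) => [|n].
  by have := mulr_ge0 c0 K20; lra.
pose g k : R := negbin (3 / 2 + k%:R) j / negbin (3 / 2 + n.+1%:R) j.
have -> : spine_mean n.+1 (fun k => 1 - (k%:R / n.+1%:R) ^+ j) - B n.+1 * c =
   spine_mean n.+1 (fun k => g k - (k%:R / n.+1%:R) ^+ j) +
   B n.+1 * c * (negbin (n.+1%:R + 1 : R) j / negbin (3 / 2 + n.+1%:R) j - 1).
  by rewrite !spine_meanB spine_mean_rising spine_mean1 -/c; ring.
have B0 := ltW (spine_drift_gt0 R n.+1).
have N0 : 0 <= n.+1%:R^-1 :> R by rewrite invr_ge0 ler0n.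
have -> : (K1 * (3 / 2) + c * K2) / n.+1%:R * B n.+1 =
  K1 / n.+1%:R * (3 / 2 * B n.+1) + B n.+1 * c * (K2 / n.+1%:R) by ring.
apply: (le_trans (ler_normD _ _)); apply: lerD.
  apply: (le_trans (ler_norm_spine_mean _ _)).
  apply: (@le_trans _ _ (spine_mean n.+1 (fun k => K1 / n.+1%:R * (1 - k%:R / n.+1%:R)))).
    by apply: ler_spine_mean => k kn; apply: h1; exact: ltnW.
  by rewrite spine_meanZ ler_wpM2l ?spine_mean_gap// mulr_ge0.
clearbody c; by rewrite normrM ger0_norm ?mulr_ge0// ler_wpM2l ?h2// mulr_ge0.
Qed.

Lemma spine_mean_logpoly J : exists2 K : R, 0 <= K & forall n,
  `|spine_mean n.+1 (fun k => logpoly J 1 - logpoly J (k%:R / n.+1%:R)) -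
    B n.+1 * drift_sum R J| <= K / n.+1%:R * B n.+1.
Proof.
elim: J => [|J [K K0 IHJ]].
  exists 0 => // n; rewrite /drift_sum big_ord0 mulr0 subr0 !mul0r.
  apply: (le_trans (ler_norm_spine_mean _ _)).
  rewrite -(spine_mean_cst n (0 : R)); apply: ler_spine_mean => k _.
  by rewrite /logpoly !big_ord0 subrr normr0.
have [K1 K10 h1] := spine_mean_pow J.+1.
have c0 : 0 <= z ^+ J.+1 / J.+1%:R by rewrite divr_ge0// exprn_ge0//; lra.
exists (K + z ^+ J.+1 / J.+1%:R * K1) => [|n]; first by rewrite addr_ge0// mulr_ge0.
rewrite /drift_sum big_ord_recr /= -/(drift_sum R J).
set c := z ^+ J.+1 / J.+1%:R in c0 *.
have -> : spine_mean n.+1 (fun k => logpoly J.+1 1 - logpoly J.+1 (k%:R / n.+1%:R)) =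
  spine_mean n.+1 (fun k => logpoly J 1 - logpoly J (k%:R / n.+1%:R)) +
  c * spine_mean n.+1 (fun k => 1 - (k%:R / n.+1%:R) ^+ J.+1).
  rewrite -spine_meanZ -spine_meanD; apply: eq_spine_mean => k _.
  by rewrite /logpoly !big_ord_recr /= !expr1n /c; ring.
set s1 := spine_mean _ _; set s2 := spine_mean _ _; set e := _ / J.+2%:R.
have -> : s1 + c * s2 - B n.+1 * (drift_sum R J + c * e) =
  (s1 - B n.+1 * drift_sum R J) + c * (s2 - B n.+1 * e) by ring.
have -> : (K + c * K1) / n.+1%:R * B n.+1 =
  K / n.+1%:R * B n.+1 + c * (K1 / n.+1%:R * B n.+1) by ring.
apply: (le_trans (ler_normD _ _)); apply: lerD; first exact: IHJ.
clearbody c; rewrite normrM ger0_norm// ler_wpM2l//; exact: h1.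
Qed.

Lemma small_expz eps : 0 < eps -> exists J, z ^+ J <= eps.
Proof.
move=> e0; have zlt : `|z| < 1 by rewrite ger0_norm; lra.
have [J _ h] := cvgr0_norm_le _ (cvg_expr zlt) _ e0.
exists J; have := h J (leqnn J); rewrite ger0_norm// exprn_ge0//; lra.
Qed.

Lemma spine_mean_log eps : 0 < eps -> exists N, forall n, (N <= n)%N ->
  `|spine_mean n.+1 (fun k => ln (3 - 2 * (k%:R / n.+1%:R))) - beta R * B n.+1|
    <= eps * B n.+1.
Proof.
(* The two truncation errors total (9/2 + 9) z^J B_n, that is (27/2) z^J B_n, so this choice of J
   leaves them half of eps. The degree J is fixed before n grows. *)
move=> e0; have e1 : 0 < eps / 27 by lra.
have [J hJ] := small_expz e1; have [K K0 hK] := spine_mean_logpoly J.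
exists (Num.bound (2 * K / eps)) => n Nn.
have B0 := ltW (spine_drift_gt0 R n.+1).
have n1 : 1 <= n.+1%:R :> R by rewrite ler1n.
have hn : K / n.+1%:R <= eps / 2.
  rewrite ler_pdivrMr; last by lra.
  have : 2 * K / eps < (Num.bound (2 * K / eps))%:R.
    by apply: archi_boundP; rewrite divr_ge0//; lra.
  have : (Num.bound (2 * K / eps))%:R <= n.+1%:R :> R by rewrite ler_nat ltnW.
  move=> h1 h2; have : 2 * K / eps <= n.+1%:R by lra.
  by rewrite ler_pdivrMr//; lra.
pose L k : R := logpoly J 1 - logpoly J (k%:R / n.+1%:R).
have -> : spine_mean n.+1 (fun k => ln (3 - 2 * (k%:R / n.+1%:R))) - beta R * B n.+1 =
  spine_mean n.+1 (fun k => ln (3 - 2 * (k%:R / n.+1%:R)) - L k) +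
  (spine_mean n.+1 L - B n.+1 * drift_sum R J) + (drift_sum R J - beta R) * B n.+1.
  by rewrite spine_meanB; ring.
have hD := drift_sum_beta R J.
have h3 : `|spine_mean n.+1 (fun k => ln (3 - 2 * (k%:R / n.+1%:R)) - L k)| <=
    3 * z ^+ J * (3 / 2 * B n.+1).
  apply: (le_trans (ler_norm_spine_mean _ _)).
  apply: (@le_trans _ _ (spine_mean n.+1 (fun k => 3 * z ^+ J * (1 - k%:R / n.+1%:R)))).
    apply: ler_spine_mean => k kn; apply: logpoly_approx.
    rewrite divr_ge0//= ler_pdivrMr; last by lra.
    by rewrite mul1r ler_nat ltnW.
  rewrite spine_meanZ ler_wpM2l ?spine_mean_gap// mulr_ge0// exprn_ge0//; lra.
apply: (le_trans (ler_normD _ _)); rewrite normrM (ger0_norm B0).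
apply: (@le_trans _ _ (3 * z ^+ J * (3 / 2 * B n.+1) + K / n.+1%:R * B n.+1 +
    9 * z ^+ J * B n.+1)).
  apply: lerD; last by rewrite ler_wpM2r.
  by apply: (le_trans (ler_normD _ _)); apply: lerD => //; exact: hK.
have -> : 3 * z ^+ J * (3 / 2 * B n.+1) + K / n.+1%:R * B n.+1 + 9 * z ^+ J * B n.+1 =
  (27 / 2 * z ^+ J + K / n.+1%:R) * B n.+1 by field; lra.
rewrite ler_wpM2r//; by move: (K / _) (z ^+ J) hn hJ => a b; lra.
Qed.

Lemma ln_le_subr1 x : 0 < x -> ln x <= x - 1.
Proof.
by move=> x0; have := @le_ln1Dx R (x - 1); rewrite [1 + _]addrC subrK; apply; lra.
Qed.

Lemma harm_le_ln (k n : nat) : (k <= n)%N ->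
  harm n - harm k <= ln (2 * n%:R + 1) - ln (2 * k%:R + 1).
Proof.
move=> kn; rewrite -(subnKC kn); elim: (n - k)%N => [|d IHd].
  by rewrite addn0 !subrr.
rewrite addnS harmS -[(k + d).+1%:R]natr1; move: IHd.
have := ler0n R (k + d)%N; move: ((k + d)%:R : R) => m m0 IHd.
suff : (3 / 2 + m)^-1 <= ln (2 * (m + 1) + 1) - ln (2 * m + 1) by lra.
have p1 : 0 < 2 * (m + 1) + 1 by lra.
have p2 : 0 < 2 * m + 1 by lra.
have := ln_le_subr1 (divr_gt0 p2 p1); rewrite ln_div ?posrE//.
have -> : (3 / 2 + m)^-1 = 1 - (2 * m + 1) / (2 * (m + 1) + 1) by field; lra.
by lra.
Qed.

Lemma ln_le_harm n : ln (2 * n%:R + 3) - ln 3 <= harm n.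
Proof.
elim: n => [|n IHn]; first by rewrite mulr0 add0r subrr /harm big_ord0.
rewrite harmS -[n.+1%:R]natr1; have := ler0n R n; move: (n%:R : R) IHn => m IHm m0.
suff : ln (2 * (m + 1) + 3) - ln (2 * m + 3) <= (3 / 2 + m)^-1 by lra.
have p1 : 0 < 2 * (m + 1) + 3 by lra.
have p2 : 0 < 2 * m + 3 by lra.
have := ln_le_subr1 (divr_gt0 p1 p2); rewrite ln_div ?posrE//.
have -> : (3 / 2 + m)^-1 = (2 * (m + 1) + 3) / (2 * m + 3) - 1 by field; lra.
by [].
Qed.

(** With x = s^2, it follows from ln s <= s - 1 and (s - 1)^2 <= s^2 - 1. *)
Lemma ln_sqr_le x : 1 <= x -> ln x ^+ 2 <= 4 * (x - 1).
Proof.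
move=> x1; have := ln_ge0 x1.
have : 1 <= Num.sqrt x by rewrite -sqrtr1 ler_wsqrtr.
have {x1} : x = Num.sqrt x ^+ 2 by rewrite sqr_sqrtr; lra.
move: (Num.sqrt x) => s -> s1; rewrite lnXn; last by lra.
have : ln s <= s - 1 by apply: ln_le_subr1; lra.
by move: (ln s) => l; rewrite mulr2n => l1 l0; nra.
Qed.

(** The square is at most that of ln ((2n+1) / (2k+1)), which [ln_sqr_le] bounds linearly in 1 /
    (2k+1), whose mean is exact by [spine_mean_inv]. The constant is 4 times 3, as (2N+1) / N <=
    3. *)
Lemma spine_mean_harm_sqr n :
  spine_mean n.+1 (fun k => (harm n.+1 - harm k) ^+ 2) <= 12 * B n.+1.
Proof.
have n1 : 1 <= n.+1%:R :> R by rewrite ler1n.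
set N : R := n.+1%:R in n1 *.
have B0 := ltW (spine_drift_gt0 R n.+1).
apply: (@le_trans _ _ (spine_mean n.+1
    (fun k => 4 * ((2 * N + 1) * (2 * k%:R + 1)^-1 - 1)))).
  apply: ler_spine_mean => k kn; have k0 := ler0n R k.
  have kN : k%:R <= N by rewrite ler_nat ltnW.
  apply: le_trans (ln_sqr_le _); last by rewrite ler_pdivlMr; lra.
  rewrite ln_div ?posrE; [|lra|lra].
  have := harm_le_ln (ltnW kn); have := harm_mono R (ltnW kn).
  rewrite -/N; move=> h1 h2; rewrite ler_sqr ?nnegrE//; lra.
rewrite spine_meanZ spine_meanB spine_meanZ spine_mean1 spine_mean_inv -/N.
have -> : 4 * ((2 * N + 1) * ((2 * N + 1)^-1 + B n.+1 / N) - 1) =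
  4 * (2 * N + 1) / N * B n.+1 by field; lra.
by rewrite ler_wpM2r// ler_pdivrMr; lra.
Qed.

(** Centring uses the decrement of [harm] rather than the exact mean of the logarithm, so that the
    corrections telescope along the chain to a function of the starting size. *)
Definition spine_incr n k : R :=
  ln (3 - 2 * (k%:R / n%:R)) - beta R * (harm n - harm k).

Lemma beta_ge0 : 0 <= beta R.
Proof.
rewrite /beta; have := sqr_sqrtr (ler0n R 3); have := sqrtr_ge0 (3 : R).
by move: (Num.sqrt 3) => r r0 r2; nra.
Qed.

Lemma beta_le2 : beta R <= 2.
Proof.
rewrite /beta; have := sqr_sqrtr (ler0n R 3); have := sqrtr_ge0 (3 : R).
by move: (Num.sqrt 3) => r r0 r2; nra.
Qed.

Lemma spine_incr_le n k : (k <= n.+1)%N ->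
  `|spine_incr n.+1 k| <= 5 * (harm n.+1 - harm k).
Proof.
move=> kn; rewrite /spine_incr; have h1 := gap_le_harm R kn; have h2 := harm_mono R kn.
have n1 : 1 <= n.+1%:R :> R by rewrite ler1n.
have x1 : k%:R / n.+1%:R <= 1 :> R.
  by rewrite ler_pdivrMr; [rewrite mul1r ler_nat | lra].
move: (k%:R / n.+1%:R) x1 h1 => x x1 h1.
have l0 : 0 <= ln (3 - 2 * x) by apply: ln_ge0; lra.
have l1 : ln (3 - 2 * x) <= 3 - 2 * x - 1 by apply: ln_le_subr1; lra.
have b0 := beta_ge0; have b2 := beta_le2.
by rewrite ler_norml; apply/andP; split; nra.
Qed.

Lemma spine_mean_norm_incr n :
  spine_mean n.+1 (fun k => `|spine_incr n.+1 k|) <= 5 * B n.+1.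
Proof.
rewrite -spine_mean_harmB -spine_meanZ; apply: ler_spine_mean => k kn.
exact/spine_incr_le/ltnW.
Qed.

Lemma spine_mean_incr_sqr n :
  spine_mean n.+1 (fun k => spine_incr n.+1 k ^+ 2) <= 300 * B n.+1.
Proof.
apply: (@le_trans _ _ (25 * (12 * B n.+1))); last by lra.
apply: le_trans (ler_wpM2l _ (spine_mean_harm_sqr n)); last by lra.
rewrite -spine_meanZ; apply: ler_spine_mean => k kn.
rewrite -real_normK ?num_real//.
have := spine_incr_le (ltnW kn); have := normr_ge0 (spine_incr n.+1 k).
by move: `|_| (harm n.+1 - harm k) => a b; nra.
Qed.

Lemma spine_mean_incr eps : 0 < eps -> exists N, forall n, (N <= n)%N ->
  `|spine_mean n.+1 (spine_incr n.+1)| <= eps * B n.+1.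
Proof.
move=> /spine_mean_log[N hN]; exists N => n /hN.
by rewrite /spine_incr spine_meanB spine_meanZ spine_mean_harmB.
Qed.

End SpineDrift.

(** * Moments of the sum of the increments along the chain *)

Section SpineMoments.
Variable R : realType.
Implicit Types (x eps : R) (n k : nat).

Local Notation B := (@spine_drift R).
Local Notation harm := (@harm R).
Local Notation incr := (@spine_incr R).

Lemma ln_nat_large x : exists N, forall n, (N <= n)%N -> x <= ln n%:R.
Proof.
exists (Num.bound (expR x)) => n Nn.
have h : expR x <= n%:R.
  apply: le_trans (ltW (archi_boundP (expR_ge0 x))) _.
  by rewrite ler_nat.
by rewrite -[leLHS]expRK ler_ln ?posrE ?expR_gt0// (lt_le_trans (expR_gt0 x)).
Qed.

Lemma harm_large x : exists N, forall n, (N <= n)%N -> x <= harm n.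
Proof.
have [N hN] := ln_nat_large (x + ln 3); exists N.+1 => n Nn.
have := hN n (ltnW Nn); have := ln_le_harm R n.
have n0 : 0 < n%:R :> R by rewrite ltr0n (leq_trans _ Nn).
have : ln n%:R <= ln (2 * n%:R + 3) :> R by rewrite ler_ln ?posrE; lra.
lra.
Qed.

(** They stand for the first two moments of the sum of the increments from size n; the recursions
    condition on the first step and expand the square. *)
Variables m s : nat -> R.
Hypothesis mS : forall n, m n.+1 = spine_mean n.+1 (fun k => m k + incr n.+1 k).
Hypothesis s0 : s 0 = 0.
Hypothesis sS : forall n, s n.+1 =
  spine_mean n.+1 (fun k => s k + 2 * (incr n.+1 k * m k) + incr n.+1 k ^+ 2).

(** Strong induction: from size N+1 on, a step adds at most eps B_n in mean, exactly what eps [harm]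
    loses in mean. The constant M absorbs the smaller sizes. *)
Lemma spine_first_moment eps : 0 < eps ->
  exists2 M : R, 0 <= M & forall n, `|m n| <= eps * harm n + M.
Proof.
move=> e0; have [N hN] := spine_mean_incr e0.
pose M : R := \sum_(i < N.+1) `|m i|.
have M0 : 0 <= M by apply: sumr_ge0.
exists M => //; elim/ltn_ind => n IHn.
have H0 := mulr_ge0 (ltW e0) (harm_ge0 R n).
have [nN | Nn] := leqP n N.
  apply: (@le_trans _ _ M); last by lra.
  rewrite /M (bigD1 (Ordinal (nN : (n < N.+1)%N)))//= lerDl.
  by apply: sumr_ge0.
case: n Nn IHn H0 => // n Nn IHn H0.
rewrite mS spine_meanD; apply: (le_trans (ler_normD _ _)).
have h1 := hN n Nn.
suff h2 : `|spine_mean n.+1 m| <= eps * (harm n.+1 - B n.+1) + M by lra.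
apply: (le_trans (ler_norm_spine_mean _ _)).
rewrite -spine_mean_harm -spine_meanZ -[in leRHS](spine_mean_cst n M) -spine_meanD.
by apply: ler_spine_mean => k kn; exact: IHn.
Qed.

(** The same clock argument. With the bound Q on |m| frozen at its value at the current size, a step
    adds at most (300 + 10 Q) B_n, less than the mean loss 300 (1 + 2Q) B_n of the right-hand
    side. *)
Lemma spine_second_moment_bound eps M : 0 < eps -> 0 <= M ->
  (forall n, `|m n| <= eps * harm n + M) ->
  forall n, s n <= 300 * harm n * (1 + 2 * (eps * harm n + M)).
Proof.
move=> e0 M0 hm; elim/ltn_ind => -[|n] IHn.
  by rewrite s0 /harm big_ord0 mulr0 mul0r.
have H0 := harm_ge0 R n.+1; have B0 := spine_drift_gt0 R n.+1.
set Q := eps * harm n.+1 + M.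
have Q0 : 0 <= Q by have := mulr_ge0 (ltW e0) H0; rewrite /Q; lra.
rewrite sS !spine_meanD spine_meanZ.
have h1 : spine_mean n.+1 s <= 300 * (1 + 2 * Q) * (harm n.+1 - B n.+1).
  rewrite -spine_mean_harm -spine_meanZ; apply: ler_spine_mean => k kn.
  apply: (le_trans (IHn k kn)); rewrite mulrAC ler_wpM2r ?harm_ge0//.
  rewrite ler_wpM2l// lerD2l ler_wpM2l// lerD2r ler_wpM2l ?(ltW e0)//.
  by apply: harm_mono; exact: ltnW.
have h2 : spine_mean n.+1 (fun k => incr n.+1 k * m k) <= Q * (5 * B n.+1).
  apply: (le_trans (ler_norm _)); apply: (le_trans (ler_norm_spine_mean _ _)).
  apply: le_trans (ler_wpM2l Q0 (spine_mean_norm_incr _ n)).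
  rewrite -spine_meanZ; apply: ler_spine_mean => k kn.
  rewrite normrM mulrC ler_wpM2r//; apply: (le_trans (hm k)).
  by rewrite lerD2r ler_wpM2l ?(ltW e0)//; apply: harm_mono; exact: ltnW.
have h3 := spine_mean_incr_sqr R n.
have QB : 0 <= Q * B n.+1 by rewrite mulr_ge0// ltW.
clearbody Q; move: (harm n.+1) (B n.+1) h1 h2 h3 QB => H b h1 h2 h3 QB.
have -> : 300 * H * (1 + 2 * Q) =
  300 * (1 + 2 * Q) * (H - b) + 300 * b + 600 * (Q * b) by ring.
lra.
Qed.

Lemma spine_second_moment eps : 0 < eps ->
  exists N, forall n, (N <= n)%N -> s n <= eps * harm n ^+ 2.
Proof.
(* The quadratic part of the bound is 600 (eps / 1200) H^2, half of the target; the linear part 300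
   (1 + 2M) H fits in the other half once H is large. *)
move=> e0; have e1 : 0 < eps / 1200 by lra.
have [M M0 hM] := spine_first_moment e1.
have [N hN] := harm_large (600 * (1 + 2 * M) / eps); exists N => n /hN hn.
apply: (le_trans (spine_second_moment_bound e1 M0 hM n)).
have H0 := harm_ge0 R n; move: hn; rewrite ler_pdivrMr//.
by move: (harm n) H0 => H H0 hn; nra.
Qed.

End SpineMoments.

(** * Averages over uniform trees *)

Lemma bintrees_height_uniq h : uniq (bintrees_height h).
Proof.
elim: h => //= h IHh; apply/andP; split.
  by apply/negP => /allpairsP[[t1 t2] []].
by apply: allpairs_uniq => // -[t1 t2] [u1 u2] _ _ /= [-> ->].
Qed.

Section TreeSums.
Variable V : nmodType.
Implicit Types g : bintree -> V.

Definition treesum g n := \sum_(t : bintree_of n) g t.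

(** The freedom in h lets both subtrees of the root range over one common list when trees are cut at
    the root. *)
Lemma treesum_height g n h : (n <= h)%N ->
  treesum g n = \sum_(t <- bintrees_height h | tsize t == n) g t.
Proof.
move=> nh; rewrite /treesum -(big_map (@tree_val n) xpredT g) -[RHS]big_filter.
apply: perm_big; apply: uniq_perm.
- by rewrite map_inj_uniq ?index_enum_uniq//; exact: val_inj.
- by rewrite filter_uniq// bintrees_height_uniq.
move=> t; rewrite mem_filter; apply/mapP/andP => [[u _ ->]|[tn _]].
  by case: u => u /= un; rewrite un mem_bintrees_height// (eqP un).
by exists (BintreeOf tn); rewrite ?mem_index_enum.
Qed.

Lemma treesum0 g : treesum g 0 = g Leaf.
Proof. by rewrite (treesum_height g (leqnn 0)) /= big_cons big_nil addr0. Qed.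

Lemma treesumS g n : treesum g n.+1 =
  \sum_(a < n.+1) treesum (fun t1 => treesum (fun t2 => g (Node t1 t2)) (n - a)) a.
Proof.
rewrite (treesum_height g (leqnn n.+1)) /= big_cons /= big_mkcond big_allpairs_dep /=.
have -> : \sum_(a < n.+1) treesum (fun t1 => treesum (fun t2 => g (Node t1 t2)) (n - a)) a =
  \sum_(a < n.+1) \sum_(t1 <- bintrees_height n | tsize t1 == a)
     \sum_(t2 <- bintrees_height n | tsize t2 == (n - a)%N) g (Node t1 t2).
  apply: eq_bigr => a _; rewrite (@treesum_height _ a n) -1?ltnS//.
  by apply: eq_bigr => t1 _; rewrite (@treesum_height _ (n - a) n) ?leq_subr.
rewrite [RHS](exchange_big_dep xpredT)//=; apply: eq_bigr => t1 _.
have [tn | nt] := ltnP (tsize t1) n.+1.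
  rewrite (big_pred1 (Ordinal tn)); last by move=> a /=; rewrite eq_sym.
  rewrite -big_mkcond /=; apply: eq_bigl => t2.
  by rewrite eqSS -(eqn_add2l (tsize t1) (tsize t2)) subnKC.
rewrite [RHS]big_pred0 => [|a]; last first.
  by rewrite /=; apply/negbTE; rewrite neq_ltn (leq_trans (ltn_ord a) nt) orbT.
rewrite -big_mkcond big_pred0//= => t2; rewrite eqSS; apply/negbTE.
by rewrite neq_ltn (leq_trans nt (leq_addr _ _)) orbT.
Qed.

End TreeSums.

(** * From the leaves of a uniform tree to the chain *)

Section TreeAverages.
Variable R : realType.
Implicit Types (G : bintree -> R) (n a : nat).

Local Notation e32 := (@negbin R (3 / 2)).

Definition treecount n : R := #|{: bintree_of n}|%:R.

Lemma treesum_cst (c : R) n : treesum (fun=> c) n = c * treecount n.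
Proof. by rewrite /treesum sumr_const mulr_natr. Qed.

Lemma treesumZ c G n : treesum (fun t => c * G t) n = c * treesum G n.
Proof. by rewrite /treesum mulr_sumr. Qed.

Lemma treesumD G G' n :
  treesum (fun t => G t + G' t) n = treesum G n + treesum G' n.
Proof. by rewrite /treesum big_split. Qed.

Lemma eq_treesum G G' n : (forall t, tsize t = n -> G t = G' t) ->
  treesum G n = treesum G' n.
Proof. by move=> GG'; apply: eq_bigr => -[t /= /eqP tn] _; exact: GG'. Qed.

Lemma treecount0 : treecount 0 = 1.
Proof. by have := treesum_cst 1 0; rewrite treesum0 mul1r. Qed.

Lemma treecountS n :
  treecount n.+1 = \sum_(a < n.+1) treecount a * treecount (n - a)%N.
Proof.
rewrite -[LHS]mul1r -treesum_cst treesumS; apply: eq_bigr => a _.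
rewrite (eq_treesum (G' := fun=> treecount (n - a)%N)).
  by rewrite treesum_cst mulrC.
by move=> t _; rewrite treesum_cst mul1r.
Qed.

Lemma negbin_N1 n : negbin (- 1 : R) n.+2 = 0.
Proof.
elim: n => [|n IHn]; last by rewrite negbinS IHn !mul0r.
by rewrite negbinS addNr mulr0 mul0r.
Qed.

(** Catalan numbers, read off (1 - sqrt (1 - 4x)) / (2x). Vandermonde's identity at (-1/2, -1/2)
    gives e_{-1}(n+2) = 0, so the inner terms of the convolution sum to minus its two equal end
    terms: this is the Catalan recursion. *)
Lemma treecountE n : treecount n = 2 * 4 ^+ n * - negbin (- (1 / 2)) n.+1.
Proof.
elim/ltn_ind: n => -[|n] IHn; first by rewrite treecount0 negbin_n1 expr0; lra.
have /esym := conv_negbin (- (1 / 2) : R) (- (1 / 2)) n.+2.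
rewrite (_ : - (1 / 2) + - (1 / 2) = -1); last by lra.
rewrite negbin_N1 /conv big_ord_recl /= subn0 big_ord_recr /= /bump /= subnn.
rewrite negbin_n0 mul1r mulr1 add1n => conv0.
rewrite treecountS.
rewrite (eq_bigr (fun a : 'I_n.+1 => 4 ^+ n.+1 *
    (negbin (- (1 / 2) : R) (1 + a)%N * negbin (- (1 / 2)) (n.+2 - (1 + a))%N))).
  by rewrite -mulr_sumr; move: conv0; set S := \sum_(_ < _) _; nra.
move=> a _; have an : (a <= n)%N by rewrite -ltnS.
rewrite !IHn ?ltnS ?leq_subr// !add1n subSS subSn// exprS.
have -> : 4 ^+ n = 4 ^+ a * 4 ^+ (n - a) :> R by rewrite -exprD subnKC.
by ring.
Qed.

Lemma treecount_neq0 n : treecount n != 0.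
Proof.
have h := lt_eqF (negbin_Nhalf_lt0 R n).
by rewrite treecountE !mulf_neq0 ?expf_neq0 ?oppr_eq0 ?h ?pnatr_eq0.
Qed.

Lemma negbin_Nhalf n :
  - negbin (- (1 / 2)) n.+1 * (2 * n.+1%:R * (2 * n%:R + 1)) = e32 n.
Proof.
rewrite -negbin_half; have := negbin_absorb (- (1 / 2) : R) n.
rewrite (_ : - (1 / 2) + 1 = 1 / 2); last by lra.
move: (negbin _ _) (negbin _ _) (n.+1%:R : R) => u v N h.
by have -> : u = - (2 * (N * v)); [lra | ring].
Qed.

Lemma growthC_factor n a : (a <= n)%N ->
  growthC R a (n - a) =
  (a.+1%:R * (2 * a%:R + 1)) / (n.+2%:R * (2 * n.+1%:R + 1)) *
  (3 - 2 * (a%:R / n.+1%:R)).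
Proof.
move=> an; rewrite /growthC subnKC//.
have a0 := ler0n R a; have an' : a%:R <= n%:R :> R by rewrite ler_nat.
rewrite !(natrM, natrD) natrB//.
rewrite -[n.+2%:R]natr1 -[n.+1%:R]natr1 -[a.+1%:R]natr1.
move: (a%:R : R) (n%:R : R) a0 an' => a' n' a0 an'.
by field; rewrite !gt_eqF//; lra.
Qed.

(** Identifies the transition probabilities of the chain: the factor 2 counts the left and right
    positions of the subtree of size a that contains the sampled leaf. *)
Lemma growthC_step n a : (a <= n)%N ->
  2 * growthC R a (n - a) * treecount (n - a)%N * treecount a =
  treecount n.+1 * spine_step R n.+1 a.
Proof.
move=> an; rewrite growthC_factor// !treecountE /spine_step subSn//.
rewrite -!negbin_Nhalf exprS.
have -> : 4 ^+ n = 4 ^+ a * 4 ^+ (n - a) :> R by rewrite -exprD subnKC.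
have := lt_eqF (negbin_Nhalf_lt0 R n.+1).
have N1 : n.+1%:R != 0 :> R by rewrite pnatr_eq0.
have N2 : n.+2%:R != 0 :> R by rewrite pnatr_eq0.
have N3 : 2 * n.+1%:R + 1 != 0 :> R by have := ler0n R n.+1; lra.
move: (negbin (- (1 / 2) : R) n.+2) (negbin (- (1 / 2) : R) (n - a).+1) => u v.
move: (negbin (- (1 / 2) : R) a.+1) (4 ^+ a : R) (4 ^+ (n - a) : R) => w p q.
move: (n.+1%:R : R) (n.+2%:R : R) N1 N2 N3 => N N' N1 N2 N3 u0.
by field; rewrite N1 N2 N3 u0.
Qed.

Definition treeavg G n := treesum G n / treecount n.

(** The argument of type [nat] of [H] is the size of the parent, on which the increment of the step
    depends. *)
Lemma treeavg_spine G (H : nat -> bintree -> R) n :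
  (forall t1 t2, G (Node t1 t2) =
     growthC R (tsize t1) (tsize t2) * H (tsize t1 + tsize t2).+1 t1 +
     growthC R (tsize t2) (tsize t1) * H (tsize t1 + tsize t2).+1 t2) ->
  treeavg G n.+1 = spine_mean n.+1 (treeavg (H n.+1)).
Proof.
move=> GE; rewrite /treeavg treesumS.
pose W a := growthC R a (n - a) * treecount (n - a)%N * treesum (H n.+1) a.
have -> : \sum_(a < n.+1) treesum (fun t1 => treesum (fun t2 => G (Node t1 t2)) (n - a)) a =
    \sum_(a < n.+1) (W a + W (n - a)%N).
  apply: eq_bigr => a _; have an : (a <= n)%N by rewrite -ltnS.
  rewrite (eq_treesum (G' := fun t1 => growthC R a (n - a) * treecount (n - a)%N * H n.+1 t1 +
      growthC R (n - a) a * treesum (H n.+1) (n - a)%N)).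
    by rewrite treesumD treesumZ treesum_cst /W subKn//; ring.
  move=> t1 t1a; rewrite (eq_treesum (G' := fun t2 => growthC R a (n - a) * H n.+1 t1 +
      growthC R (n - a) a * H n.+1 t2)).
    by rewrite treesumD treesum_cst treesumZ; ring.
  by move=> t2 t2a; rewrite GE t1a t2a subnKC.
(* Exchanging left and right maps a to n - a, so the right subtrees contribute as much as the left
   ones. *)
rewrite big_split /= [X in _ + X](_ : _ = \sum_(a < n.+1) W a); last first.
  by rewrite [RHS](reindex_inj rev_ord_inj) /=; apply: eq_bigr => a _; rewrite subSS.
rewrite -mulr2n -mulr_natl mulr_sumr mulr_suml; apply: eq_bigr => a _.
have an : (a <= n)%N by rewrite -ltnS.
have -> : spine_step R n.+1 a = 2 * growthC R a (n - a) * treecount (n - a)%N * treecount a /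
    treecount n.+1.
  by rewrite growthC_step// mulrAC divff ?treecount_neq0// mul1r.
have := treecount_neq0 n.+1; have := treecount_neq0 a; rewrite /W.
move: (treecount a) (treecount n.+1) => x y x0 y0.
by field; rewrite x0 y0.
Qed.

Lemma treeavg0 G : treeavg G 0 = G Leaf.
Proof. by rewrite /treeavg treesum0 treecount0 divr1. Qed.

Lemma treeavgD G G' n : treeavg (fun t => G t + G' t) n = treeavg G n + treeavg G' n.
Proof. by rewrite /treeavg treesumD mulrDl. Qed.

Lemma treeavgZ c G n : treeavg (fun t => c * G t) n = c * treeavg G n.
Proof. by rewrite /treeavg treesumZ mulrA. Qed.

Lemma treeavg_size (f : nat -> R) n : treeavg (fun t => f (tsize t)) n = f n.
Proof.
rewrite /treeavg (eq_treesum (G' := fun=> f n)); last by move=> t ->.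
by rewrite treesum_cst mulfK ?treecount_neq0.
Qed.

Lemma eq_treeavg G G' n : (forall t, tsize t = n -> G t = G' t) ->
  treeavg G n = treeavg G' n.
Proof. by move=> /eq_treesum; rewrite /treeavg => ->. Qed.

Definition log_center n : R := ln (n.+1%:R * (2 * n%:R + 1)) - beta R * harm R n.

Definition log_dev t (l : leaf t) : R := ln (leaf_weight R l) + log_center (tsize t).

Lemma leaf_weight_gt0 t (l : leaf t) : 0 < leaf_weight R l.
Proof.
by elim: t l => [|t1 IH1 t2 IH2] //= [l|l]; rewrite mulr_gt0// divr_gt0// ltr0n
   !(muln_gt0, addn_gt0, orbT).
Qed.

(** In [growthC_factor] the quotient telescopes with the first part of [log_center]; what is left is
    ln (3 - 2x), compensated by [harm]. *)
Lemma log_center_incr n a : (a <= n)%N ->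
  ln (growthC R a (n - a)) + log_center n.+1 = log_center a + spine_incr R n.+1 a.
Proof.
move=> an; rewrite growthC_factor// /log_center /spine_incr.
have a0 := ler0n R a.
have x1 : a%:R / n.+1%:R <= 1 :> R.
  by rewrite ler_pdivrMr ?ltr0n// mul1r ler_nat; exact: leqW.
have p1 : 0 < a.+1%:R * (2 * a%:R + 1) :> R by rewrite mulr_gt0 ?ltr0n//; lra.
have p2 : 0 < n.+2%:R * (2 * n.+1%:R + 1) :> R.
  by rewrite mulr_gt0 ?ltr0n//; have := ler0n R n.+1; lra.
have p3 : 0 < 3 - 2 * (a%:R / n.+1%:R) :> R by move: (_ / _) x1 => x; lra.
rewrite (@lnM _ (_ / _)) ?posrE//; last by rewrite divr_gt0.
by rewrite (@ln_div _ (a.+1%:R * _)) ?posrE//; ring.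
Qed.

Lemma log_dev_node t1 t2 (l : leaf t1) (s := (tsize t1 + tsize t2)%N) :
  ln (growthC R (tsize t1) (tsize t2) * leaf_weight R l) + log_center s.+1 =
  log_dev l + spine_incr R s.+1 (tsize t1).
Proof.
rewrite lnM ?posrE ?leaf_weight_gt0//; last first.
  by rewrite divr_gt0// ltr0n !(muln_gt0, addn_gt0, orbT).
have := @log_center_incr s (tsize t1) (leq_addr _ _).
by rewrite /s addKn /log_dev; lra.
Qed.

Definition leaf_mean t (f : leaf t -> R) := \sum_l leaf_weight R l * f l.

Lemma leaf_mean1 t : leaf_mean (fun _ : leaf t => 1) = 1.
Proof.
rewrite -[RHS](leaf_measure_setT R t) /leaf_measure /leaf_mean.
by apply: eq_big => [l|l _]; rewrite ?finset.in_setT ?mulr1.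
Qed.

Definition log_dev_mean t := leaf_mean (@log_dev t).

Definition log_dev_sqr_mean t := leaf_mean (fun l : leaf t => log_dev l ^+ 2).

Lemma leaf_mean_shift t c :
  leaf_mean (fun l : leaf t => log_dev l + c) = log_dev_mean t + c.
Proof.
rewrite -[c in RHS]mulr1 -(leaf_mean1 t) /log_dev_mean /leaf_mean mulr_sumr -big_split.
by apply: eq_bigr => l _ /=; ring.
Qed.

Lemma leaf_mean_shift_sqr t c : leaf_mean (fun l : leaf t => (log_dev l + c) ^+ 2) =
  log_dev_sqr_mean t + 2 * (c * log_dev_mean t) + c ^+ 2.
Proof.
rewrite -[c ^+ 2]mulr1 -[X in _ = _ + _ * X](leaf_mean1 t).
rewrite /log_dev_sqr_mean /log_dev_mean /leaf_mean !mulr_sumr -!big_split.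
by apply: eq_bigr => l _ /=; ring.
Qed.

(** Stated for any [f] so as to serve both moments, with the identity and with the square. *)
Lemma leaf_mean_node t1 t2 (f : R -> R) (s := (tsize t1 + tsize t2)%N) :
  leaf_mean (fun l : leaf (Node t1 t2) => f (log_dev l)) =
  growthC R (tsize t1) (tsize t2) *
    leaf_mean (fun l : leaf t1 => f (log_dev l + spine_incr R s.+1 (tsize t1))) +
  growthC R (tsize t2) (tsize t1) *
    leaf_mean (fun l : leaf t2 => f (log_dev l + spine_incr R s.+1 (tsize t2))).
Proof.
rewrite /leaf_mean big_sumType !mulr_sumr; congr (_ + _); apply: eq_bigr => l _.
  by rewrite /= mulrA -log_dev_node.
by rewrite /= mulrA /s addnC -log_dev_node /log_dev /= addnC.
Qed.

Lemma treeavg_log_dev_sqr eps : 0 < eps ->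
  exists N, forall n, (N <= n)%N -> treeavg log_dev_sqr_mean n <= eps * harm R n ^+ 2.
Proof.
have dev0 : log_dev (tt : leaf Leaf) = 0.
  rewrite /log_dev /log_center /= /harm big_ord0 mulr0.
  by rewrite mulr0 add0r mulr1 ln1 subrr addr0.
apply: (@spine_second_moment _ (treeavg log_dev_mean)).
- move=> n; rewrite (treeavg_spine
      (H := fun n t => log_dev_mean t + spine_incr R n (tsize t))).
    by apply: eq_spine_mean => k _; rewrite treeavgD treeavg_size.
  by move=> t1 t2; rewrite /log_dev_mean (leaf_mean_node _ _ id) !leaf_mean_shift.
- rewrite treeavg0 /log_dev_sqr_mean /leaf_mean (big_pred1 tt) => [|[]//].
  by rewrite dev0 expr0n mulr0.
- move=> n; rewrite (treeavg_spine (H := fun n t => log_dev_sqr_mean t +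
      2 * (spine_incr R n (tsize t) * log_dev_mean t) + spine_incr R n (tsize t) ^+ 2)).
    apply: eq_spine_mean => k _; rewrite !treeavgD treeavgZ.
    rewrite (treeavg_size (fun k => spine_incr R n.+1 k ^+ 2)); congr (_ + 2 * _ + _).
    by rewrite -[RHS]treeavgZ; apply: eq_treeavg => t ->.
  move=> t1 t2; rewrite /log_dev_sqr_mean (leaf_mean_node _ _ (fun x => x ^+ 2)).
  by rewrite !leaf_mean_shift_sqr.
Qed.

End TreeAverages.

(** * Typical leaves *)

Section TypicalLeaves.
Variable R : realType.
Implicit Types (eps delta : R) (n : nat) (t : bintree).

Lemma harm_le_ln_nat n : (0 < n)%N -> harm R n <= ln n%:R + ln 3.
Proof.
move=> n0; have n1 : 1 <= n%:R :> R by rewrite ler1n.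
have := harm_le_ln R (leq0n n); rewrite {2}/harm big_ord0 subr0 mulr0 add0r ln1 subr0.
move=> h; apply: (le_trans h); rewrite -lnM ?posrE//; last by lra.
by rewrite ler_ln ?posrE; lra.
Qed.

Lemma ln_nat_le_harm n : (0 < n)%N -> ln n%:R - ln 3 <= harm R n.
Proof.
move=> n0; have n1 : 1 <= n%:R :> R by rewrite ler1n.
apply: le_trans (ln_le_harm R n); rewrite lerD2r ler_ln ?posrE; lra.
Qed.

(** Here gamma = 2 - beta: (n+1)(2n+1) lies between n^2 and 6 n^2, and [harm] is within ln 3 of ln
    n, with beta <= 2. *)
Lemma log_center_asymp : exists K : R, forall n, (0 < n)%N ->
  `|log_center R n - gamma R * ln n%:R| <= K.
Proof.
exists (ln 6 + 2 * ln 3) => n n0.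
have n1 : 1 <= n%:R :> R by rewrite ler1n.
have h1 := harm_le_ln_nat n0; have h2 := ln_nat_le_harm n0.
have b0 := beta_ge0 R; have b2 := beta_le2 R.
have -> : gamma R = 2 - beta R by rewrite /gamma /beta; ring.
have l3 : 0 <= ln 3 :> R by apply: ln_ge0; lra.
have l6 : 0 <= ln 6 :> R by apply: ln_ge0; lra.
have u1 : ln n%:R *+ 2 <= ln (n.+1%:R * (2 * n%:R + 1)) :> R.
  rewrite -lnXn ?ler_ln ?posrE ?exprn_gt0 -?natr1; nra.
have u2 : ln (n.+1%:R * (2 * n%:R + 1)) <= ln n%:R *+ 2 + ln 6 :> R.
  rewrite -lnXn -?lnM ?ler_ln ?posrE ?exprn_gt0 -?natr1 ?mulr_gt0 ?exprn_gt0; nra.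
rewrite mulr2n in u1 u2; rewrite /log_center.
move: (ln (_ * _)) (ln n%:R) (harm R n) (beta R) u1 u2 h1 h2 b0 b2 => u L H b.
by move=> u1 u2 h1 h2 b0 b2; rewrite ler_norml; apply/andP; split; nra.
Qed.

Definition typical eps n t : {set leaf t} :=
  [set l : leaf t | n%:R `^ (- gamma R - eps) <= leaf_weight R l
                                      <= n%:R `^ (- gamma R + eps)]%SET.

Lemma atypical_log_dev eps : 0 < eps -> exists N, forall n, (N <= n)%N ->
  forall t (l : leaf t), tsize t = n -> l \notin typical eps n t ->
  (eps / 2 * ln n%:R) ^+ 2 <= log_dev R l ^+ 2.
Proof.
move=> e0; have [K hK] := log_center_asymp.
(* Replacing gamma ln n by [log_center] then costs at most half of the margin eps ln n. *)
have [N hN] := ln_nat_large (`|K| * 2 / eps); exists N.+1 => n Nn t l tn.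
have n0 : (0 < n)%N by exact: leq_ltn_trans Nn.
have n0' : 0 < n%:R :> R by rewrite ltr0n.
have hn := hN n (ltnW Nn); have := hK n n0.
have w0 := leaf_weight_gt0 R l.
have L0 : 0 <= ln n%:R :> R by rewrite ln_ge0// ler1n.
rewrite finset.inE -[X in X && _]ler_ln ?posrE ?powR_gt0//.
rewrite -[X in _ && X]ler_ln ?posrE ?powR_gt0// !ln_powR /log_dev tn.
rewrite ler_pdivrMr// in hn.
have hK' := ler_norm K.
move: (ln (leaf_weight R l)) (log_center R n) (ln n%:R) (gamma R) L0 hn => w c L g L0 hn.
rewrite ler_norml => /andP[c1 c2].
have : eps / 2 * L <= `|w + c| -> (eps / 2 * L) ^+ 2 <= (w + c) ^+ 2.
  move=> h; rewrite -[leRHS]real_normK ?num_real// ler_sqr ?nnegrE//.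
  by rewrite mulr_ge0//; lra.
move=> h; rewrite negb_and -!ltNge => /orP[w1|w1]; apply: h; rewrite ler_normr.
  by apply/orP; right; nra.
by apply/orP; left; nra.
Qed.

Lemma leaf_measure_le1 t (A : {set leaf t}) : leaf_measure R A <= 1.
Proof.
rewrite -(leaf_measure_setT R t) /leaf_measure [leRHS](bigID (mem A)) /=.
rewrite [X in _ <= X + _](eq_bigl (mem A)) => [|l]; last by rewrite finset.in_setT.
by rewrite lerDl sumr_ge0// => l _; exact: leaf_weight_ge0.
Qed.

Lemma leaf_measureC t (A : {set leaf t}) :
  1 - leaf_measure R A = \sum_(l | l \notin A) leaf_weight R l.
Proof.
rewrite -(leaf_measure_setT R t) /leaf_measure (bigID (mem A)) /=.
rewrite (eq_bigl (mem A)) => [|l]; last by rewrite finset.in_setT.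
by rewrite addrAC subrr add0r; apply: eq_bigl => l; rewrite finset.in_setT.
Qed.

Lemma treeavg_atypical eps delta : 0 < eps -> 0 < delta ->
  exists N, forall n, (N <= n)%N ->
    treeavg (fun t => 1 - leaf_measure R (typical eps n t)) n <= delta.
Proof.
move=> e0 d0; have [N1 h1] := atypical_log_dev e0.
(* Below, ln n >= 1 + ln 3 ensures [harm] <= 2 ln n, so that eps/4 against [harm] becomes eps/2
   against ln n. *)
have d1 : 0 < delta * (eps / 4) ^+ 2 by rewrite mulr_gt0// exprn_gt0//; lra.
have [N2 h2] := treeavg_log_dev_sqr d1.
have [N3 h3] := ln_nat_large (1 + ln 3 : R).
exists (N1 + N2 + N3).+1 => n Nn.
have n0 : (0 < n)%N by exact: leq_ltn_trans Nn.
have l3 : 0 <= ln 3 :> R by apply: ln_ge0; lra.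
have L1 : 1 + ln 3 <= ln n%:R :> R.
  by apply: h3; apply: leq_trans (ltnW Nn); rewrite leq_addl.
have {}h2 := h2 n (leq_trans (leq_trans (leq_addl N1 N2) (leq_addr N3 _)) (ltnW Nn)).
have {}h1 := h1 n (leq_trans (leq_trans (leq_addr N2 N1) (leq_addr N3 _)) (ltnW Nn)).
have hH := harm_le_ln_nat n0; have H0 := harm_ge0 R n.
set L : R := ln n%:R in L1 h1 hH.
have c0 : 0 < (eps / 2 * L) ^+ 2 by rewrite exprn_gt0// mulr_gt0//; lra.
apply: (@le_trans _ _ (treeavg (fun t => (eps / 2 * L) ^- 2 * log_dev_sqr_mean R t) n)).
  rewrite /treeavg ler_wpM2r ?invr_ge0 ?ler0n//.
  apply: ler_sum => -[t /= /eqP tn] _; rewrite leaf_measureC.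
  rewrite /log_dev_sqr_mean /leaf_mean mulr_sumr big_mkcond /=.
  apply: ler_sum => l _; have w0 := leaf_weight_ge0 R l.
  case: ifPn => [lt | _]; last first.
    by rewrite mulr_ge0 ?invr_ge0 ?(ltW c0)// mulr_ge0// sqr_ge0.
  by rewrite mulrCA ler_peMr// mulrC ler_pdivlMr// mul1r h1.
rewrite treeavgZ mulrC ler_pdivrMr//; apply: (le_trans h2).
have hL : eps / 4 * harm R n <= eps / 2 * L by nra.
rewrite -[leLHS]mulrA -exprMn ler_wpM2l ?(ltW d0)// ler_sqr ?nnegrE//.
  by rewrite mulr_ge0//; lra.
by rewrite mulr_ge0//; lra.
Qed.

Lemma unif_prob_ge0 (T : finType) (E : pred T) : 0 <= unif_prob R E.
Proof. by rewrite /unif_prob divr_ge0. Qed.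

Lemma unif_prob_markov n (E : pred (bintree_of n)) (G : bintree -> R) c :
  0 < c -> (forall t, 0 <= G t) -> (forall t : bintree_of n, E t -> c <= G t) ->
  unif_prob R E <= treeavg G n / c.
Proof.
move=> c0 G0 EG; rewrite /unif_prob /treeavg mulrAC ler_wpM2r ?invr_ge0 ?ler0n//.
rewrite ler_pdivlMr// mulr_natl -sumr_const.
apply: (@le_trans _ _ (\sum_(t in E) G t)).
  by apply: ler_sum => t tE; exact: EG.
rewrite /treesum [leRHS](bigID (mem E)) /= lerDl.
by apply: sumr_ge0 => t _; exact: G0.
Qed.

Lemma unif_probC n (E : pred (bintree_of n)) :
  unif_prob R E = 1 - unif_prob R (predC E).
Proof.
rewrite -(divff (treecount_neq0 R n)) /unif_prob /treecount -mulrBl -(cardC E) natrD.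
by rewrite addrK.
Qed.

Lemma unif_prob_cvg0 (E : forall n, pred (bintree_of n)) :
  (forall delta, 0 < delta ->
     exists N, forall n, (N <= n)%N -> unif_prob R (E n) <= delta) ->
  unif_prob R (E n) @[n --> \oo] --> (0 : R).
Proof.
move=> h; apply/cvgrPdist_le => delta /h[N hN]; exists N => // n /= Nn.
by rewrite sub0r normrN ger0_norm ?unif_prob_ge0// hN.
Qed.

(** Markov's inequality for the mass of the atypical leaves: an event that forces this mass to be at
    least eta becomes negligible. *)
Lemma unif_prob_atypical eps eta (E : forall n, pred (bintree_of n)) :
  0 < eps -> 0 < eta ->
  (exists N, forall n, (N <= n)%N -> forall t : bintree_of n, E n t ->
     eta <= 1 - leaf_measure R (typical eps n t)) ->
  unif_prob R (E n) @[n --> \oo] --> (0 : R).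
Proof.
move=> e0 eta0 [N1 hE]; apply: unif_prob_cvg0 => delta d0.
have [N2 h2] := treeavg_atypical e0 (mulr_gt0 d0 eta0).
exists (N1 + N2)%N => n Nn.
have {}h2 := h2 n (leq_trans (leq_addl _ _) Nn).
apply: le_trans (_ : _ <= delta * eta / eta) _; last by rewrite mulfK ?gt_eqF.
apply: le_trans (ler_wpM2r _ h2); last by rewrite invr_ge0 ltW.
apply: unif_prob_markov => // [t|t]; first by rewrite subr_ge0 leaf_measure_le1.
exact/hE/(leq_trans (leq_addr _ _) Nn).
Qed.

Lemma card_heavy_leaves eps n t : (0 < n)%N ->
  #|[set l : leaf t | n%:R `^ (- gamma R - eps) <= leaf_weight R l]%SET|%:R
    <= n%:R `^ (gamma R + eps).
Proof.
move=> n0; have n0' : 0 < n%:R :> R by rewrite ltr0n.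
set A := finset _.
have -> : n%:R `^ (gamma R + eps) = (n%:R `^ (- gamma R - eps))^-1.
  by rewrite -powRN opprD !opprK.
rewrite -[leRHS]mul1r ler_pdivlMr ?powR_gt0//.
apply: le_trans (leaf_measure_le1 A); rewrite mulr_natl -sumr_const.
by apply: ler_sum => l; rewrite finset.inE.
Qed.

(** The typical leaves of A number at most n^(gamma-eps) and weigh at most n^(-gamma+eps/2) each;
    the others are covered by the atypical mass. *)
Lemma leaf_measure_few_leaves eps n t (A : {set leaf t}) : (0 < n)%N ->
  #|A|%:R <= n%:R `^ (gamma R - eps) ->
  leaf_measure R A <=
    (1 - leaf_measure R (typical (eps / 2) n t)) + n%:R `^ (- (eps / 2)).
Proof.
move=> n0 cA; have n0' : 0 < n%:R :> R by rewrite ltr0n.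
set T := typical _ _ _.
rewrite leaf_measureC /leaf_measure (bigID (mem T)) /= addrC; apply: lerD.
  rewrite [leRHS](bigID (mem A)) /=.
  rewrite (eq_bigl (fun l => (l \notin T) && (l \in A))) => [|l]; last by rewrite andbC.
  by rewrite lerDl sumr_ge0// => l _; exact: leaf_weight_ge0.
apply: (@le_trans _ _ (\sum_(l in A) n%:R `^ (- gamma R + eps / 2))).
  rewrite [leRHS](bigID (mem T)) /= -[leLHS]addr0 lerD//.
    by apply: ler_sum => l /andP[_]; rewrite finset.inE => /andP[].
  by apply: sumr_ge0 => l _; exact: powR_ge0.
rewrite sumr_const -[leLHS]mulr_natl.
apply: (@le_trans _ _ (n%:R `^ (gamma R - eps) * n%:R `^ (- gamma R + eps / 2))).
  by rewrite ler_wpM2r ?powR_ge0.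
rewrite -powRD; last by rewrite (gt_eqF n0') implybT.
by rewrite (_ : gamma R - eps + (- gamma R + eps / 2) = - (eps / 2))//; lra.
Qed.

Lemma powR_nat_small eps delta : 0 < eps -> 0 < delta ->
  exists N, forall n, (N <= n)%N -> n%:R `^ (- eps) <= delta.
Proof.
move=> e0 d0; have [N hN] := ln_nat_large (- ln delta / eps).
exists N.+1 => n Nn; have n0 : 0 < n%:R :> R by rewrite ltr0n (leq_trans _ Nn).
have := hN n (ltnW Nn); rewrite ler_pdivrMr// => h.
by rewrite -ler_ln ?posrE ?powR_gt0// ln_powR; lra.
Qed.

End TypicalLeaves.

Theorem theorem1p1 (R : realType) :
  [/\ forall eps : R, 0 < eps ->
        cvg_in_prob (fun n (t : bintree_of n) =>
          leaf_measure R [set l : leaf t |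
            n%:R `^ (- gamma R - eps) <= leaf_weight R l
                                      <= n%:R `^ (- gamma R + eps)]%SET) 1,
      forall eps delta : R, 0 < eps -> 0 < delta < 1 ->
        unif_prob R (fun t : bintree_of n =>
          [exists A : {set leaf t},
             (1 - delta <= leaf_measure R A)
             && (#|A|%:R <= n%:R `^ (gamma R + eps))]) @[n --> \oo] --> (1 : R)
    & forall eps : R, 0 < eps ->
        cvg_in_prob (fun n (t : bintree_of n) =>
          \big[Num.max/0]_(A : {set leaf t}
             | #|A|%:R <= n%:R `^ (gamma R - eps)) leaf_measure R A) 0 ].
Proof.
split.
- move=> eps e0 eta eta0; apply: (unif_prob_atypical e0 eta0).
  exists 0%N => n _ t; rewrite -/(typical eps n t) ler0_norm ?opprB => [/ltW//|].
  by rewrite subr_le0 leaf_measure_le1.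
- move=> eps delta e0 /andP[d0 _].
  pose E n (t : bintree_of n) := [exists A : {set leaf t},
    (1 - delta <= leaf_measure R A) && (#|A|%:R <= n%:R `^ (gamma R + eps))].
  rewrite (_ : (fun n => _) = fun n => 1 - unif_prob R (predC (@E n))).
    rewrite -[X in _ --> X]subr0; apply: cvgB; first exact: cvg_cst.
    apply: (unif_prob_atypical (E := fun n => predC (@E n)) e0 d0).
    exists 1%N => n n0 t /=; apply: contraNT; rewrite -ltNge => dt.
    (* Dropping the upper bound on the weight leaves the cardinality bound intact and keeps all the
       typical leaves. *)
    apply/existsP; exists [set l : leaf t | n%:R `^ (- gamma R - eps) <= leaf_weight R l]%SET.
    rewrite card_heavy_leaves// andbT.
    apply: (@le_trans _ _ (leaf_measure R (typical eps n t))); first by lra.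
    rewrite /leaf_measure [leRHS](bigID (mem (typical eps n t))) /= -[leLHS]addr0 lerD//.
      rewrite [leRHS](eq_bigl (mem (typical eps n t)))// => l.
      by rewrite !finset.inE; case: (_ <= _).
    by apply: sumr_ge0 => l _; exact: leaf_weight_ge0.
  by apply/funext => n; rewrite -unif_probC.
- move=> eps e0 eta eta0; have e2 : 0 < eps / 2 by lra.
  have eta2 : 0 < eta / 2 by lra.
  apply: (unif_prob_atypical e2 eta2).
  (* For large n the term n^(-eps/2) uses up at most half of eta, so the atypical mass must supply
     the other half. *)
  have [N hN] := powR_nat_small e2 eta2; exists N.+1 => n Nn t.
  have n0 : (0 < n)%N by exact: leq_ltn_trans Nn.
  have {}hN := hN n (ltnW Nn).
  rewrite subr0 ger0_norm; last exact: bigmax_ge_id.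
  set M := \big[_/_]_(_ | _) _.
  suff : M <= (1 - leaf_measure R (typical (eps / 2) n t)) + n%:R `^ (- (eps / 2)) by lra.
  apply: bigmax_le => [|A cA]; last exact: leaf_measure_few_leaves.
  by rewrite addr_ge0 ?powR_ge0// subr_ge0 leaf_measure_le1.
Qed.
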